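(* Assume that the pair $(\mathbf{U}_h,Z_h)$ satisfies the discrete inf-sup condition: there is a constant $C_0>0$ (independent of $h$) such that for all $w\in Z_h$, $$\sup_{0\ne\mathbf{v}_h\in\mathbf{U}_h}\frac{(w,\nabla\cdot\mathbf{v}_h)}{|\mathbf{v}_h|_1}\ge C_0\|w\|.$$ Let $(\mathbf{u},q,p)$ be the solution of the weak three-field problem and $(\mathbf{u}_h,q_h,p_h)$ the solution of the semi-discrete scheme (both given in the context). Then there exists a constant $C$, independent of $h$, such that for each $t\in(0,\bar T]$ $$\mu\|\varepsilon(e_h^{\mathbf{u}}(t))\|^2+\|e_h^q(t)\|^2\le C\Big(\mu\|\varepsilon(\eta_h^{\mathbf{u}}(t))\|^2+\|\eta_h^q(t)\|^2+\int_0^t\|\eta^q_{ht}-\eta^p_{ht}\|^2\,ds\Big)$$ and $$\kappa\|\nabla e_h^p(t)\|^2\le C\Big(\kappa\|\nabla\eta_h^p(t)\|^2+\int_0^t\|\eta^q_{ht}-\eta^p_{ht}\|^2\,ds\Big).$$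
   Context: $\Omega\subset\mathbb{R}^d$, $d=2,3$, is an open bounded polygonal or polyhedral domain; $\Gamma_D,\Gamma_N$ are disjoint closed subsets of $\partial\Omega$ with $\Gamma_D\cup\Gamma_N=\partial\Omega$ and $|\Gamma_D|\neq0$; $\bar T>0$ is the final time. The parameters $\mu,\lambda,\kappa\in(0,\infty)$ are constants. $\varepsilon(\mathbf{u})=\frac12(\nabla\mathbf{u}+(\nabla\mathbf{u})^T)$. The data are $\mathbf{f},g$ on $\Omega\times(0,\bar T]$, $\beta,\gamma$ on $\Gamma_N\times(0,\bar T]$, and initial data $\varphi$ (displacement), $\phi$ (pressure). $(\cdot,\cdot)$ and $\|\cdot\|$ are the $L^2(\Omega)$ inner product and norm, $|\cdot|_1$ is the $H^1$ seminorm, and $\langle\cdot,\cdot\rangle_{\Gamma_N}$ is the $L^2(\Gamma_N)$ inner product. A subscript $t$ denotes the time derivative. $[H^1_{0,D}(\Omega)]^d=\{\mathbf{v}\in[H^1(\Omega)]^d:\mathbf{v}=\mathbf{0}\text{ on }\Gamma_D\}$ and $H^1_{0,D}(\Omega)=\{v\in H^1(\Omega):v=0\text{ on }\Gamma_D\}$. Weak problem: find $\mathbf{u}(t)\in[H^1_{0,D}(\Omega)]^d$, $q(t)\in L^2(\Omega)$, $p(t)\in H^1_{0,D}(\Omega)$ with $\mathbf{u}(0)=\varphi$, $p(0)=\phi$, $q(0)=-\lambda\nabla\cdot\varphi+\phi$ such that $2\mu(\varepsilon(\mathbf{u}),\varepsilon(\mathbf{v}))-(q,\nabla\cdot\mathbf{v})=(\mathbf{f},\mathbf{v})+\langle\beta,\mathbf{v}\rangle_{\Gamma_N}$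 for all $\mathbf{v}\in[H^1_{0,D}(\Omega)]^d$; $(\lambda^{-1}(q-p),w_q)+(\nabla\cdot\mathbf{u},w_q)=0$ for all $w_q\in L^2(\Omega)$; $-(\lambda^{-1}(q_t-p_t),w_p)+\kappa(\nabla p,\nabla w_p)=(g,w_p)+\langle\gamma,w_p\rangle_{\Gamma_N}$ for all $w_p\in H^1_{0,D}(\Omega)$. $\mathcal{T}_h$ is a regular, quasi-uniform triangulation of $\Omega$ into triangles or tetrahedra with mesh size $h=\max_{T\in\mathcal{T}_h}h_T$, where $h_T$ is the diameter of $T$. $P_m(T)$ denotes polynomials of degree at most $m$ on $T$. For integers $k\ge2$, $l\ge0$: $\mathbf{U}_h=\{\mathbf{v}\in[H^1_{0,D}(\Omega)]^d\cap[C^0(\Omega)]^d:\mathbf{v}|_T\in[P_k(T)]^d\ \forall T\in\mathcal{T}_h\}$, $Z_h=\{q\in L^2(\Omega):q|_T\in P_l(T)\ \forall T\in\mathcal{T}_h\}$, $P_h=\{p\in H^1_{0,D}(\Omega)\cap C^0(\Omega):p|_T\in P_{k-1}(T)\ \forall T\in\mathcal{T}_h\}$. Stokes projection: for a pair $(\mathbf{u},q)\in[H^1_{0,D}(\Omega)]^d\times L^2(\Omega)$, the pair $(Q_h^{\mathbf{u}}\mathbf{u},Q_h^q q)\in\mathbf{U}_h\times Z_h$ is defined by $2\mu(\varepsilon(Q_h^{\mathbf{u}}\mathbf{u}),\varepsilon(\mathbf{v}))-(Q_h^qq,\nabla\cdot\mathbf{v})=2\mu(\varepsilon(\mathbf{u}),\varepsilon(\mathbf{v}))-(q,\nabla\cdot\mathbf{v})$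 for all $\mathbf{v}\in\mathbf{U}_h$, and $(w_q,\nabla\cdot Q_h^{\mathbf{u}}\mathbf{u})=(w_q,\nabla\cdot\mathbf{u})$ for all $w_q\in Z_h$. Elliptic projection: $Q_h^p:H^1_{0,D}(\Omega)\to P_h$ is defined by $(\nabla Q_h^pp,\nabla w_p)=(\nabla p,\nabla w_p)$ for all $w_p\in P_h$. Semi-discrete scheme: with $\mathbf{u}_h(0)=Q_h^{\mathbf{u}}\varphi$, $q_h(0)=Q_h^q(-\lambda\nabla\cdot\varphi+\phi)$, $p_h(0)=Q_h^p\phi$, find $\mathbf{u}_h(t)\in\mathbf{U}_h$, $q_h(t)\in Z_h$, $p_h(t)\in P_h$ satisfying the three equations of the weak problem with $(\mathbf{u},q,p)$ replaced by $(\mathbf{u}_h,q_h,p_h)$ and test functions ranging over $\mathbf{U}_h$, $Z_h$, $P_h$ respectively. Errors: $e_h^{\mathbf{u}}=\mathbf{u}-\mathbf{u}_h$, $e_h^q=q-q_h$, $e_h^p=p-p_h$; projection errors: $\eta_h^{\mathbf{u}}=\mathbf{u}-Q_h^{\mathbf{u}}\mathbf{u}$, $\eta_h^q=q-Q_h^qq$, $\eta_h^p=p-Q_h^pp$ (the Stokes projection being applied to the pair $(\mathbf{u}(t),q(t))$); $\eta^q_{ht}=\partial_t\eta_h^q$, $\eta^p_{ht}=\partial_t\eta_h^p$. *)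

(* Defs.v *)
From HB Require Import structures.
From mathcomp Require Import all_boot all_order all_algebra.
From mathcomp Require Import all_classical all_reals all_analysis.
From mathcomp Require Import measurable_realfun.
Import Order.TTheory GRing.Theory Num.Theory.
Import numFieldNormedType.Exports.

Set Implicit Arguments.
Unset Strict Implicit.
Unset Printing Implicit Defensive.

Local Open Scope classical_set_scope.
Local Open Scope ring_scope.

Definition borel_display : measure_display.
Proof. exact. Qed.

Section borel.
Variables (R : realType) (n : nat).

Definition borel : set (set 'rV[R]_n) := <<s open >>.

Let borel0 : borel set0. Proof. exact: sigma_algebra0. Qed.
Let borelC A : borel A -> borel (~` A). Proof. exact: sigma_algebraC. Qed.
Let borel_bigcup (F : (set 'rV[R]_n)^nat) :
  (forall i, borel (F i)) -> borel (\bigcup_i F i).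
Proof. exact: sigma_algebra_bigcup. Qed.

HB.instance Definition _ := @isMeasurable.Build borel_display 'rV[R]_n
  borel borel0 borelC borel_bigcup.

End borel.

Section lebesgue_vector.
Variable R : realType.

Lemma measurable_fun_rV d (T : measurableType d) n (f : T -> 'rV[R]_n) :
  (forall i, measurable_fun setT (fun x => f x 0 i)) -> measurable_fun setT f.
Proof.
move=> mf; apply: (@measurability _ _ _ _ _ _ (@open _ : set (set ('rV[R]_n))) erefl).
move=> _ [U oU <-]; rewrite setTI.
pose box (c : 'rV[rat]_n * nat) :=
  [set y : 'rV[R]_n | forall i, ball (ratr (c.1 0 i) : R) c.2.+1%:R^-1 (y 0 i)].
have UE : U = \bigcup_(c in [set c | box c `<=` U]) box c.
  apply/seteqP; split=> [x Ux|x [c cU]]; last exact: cU.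
  have /nbhs_ballP[e /= e0 eU] : nbhs x U by exact: open_nbhs_nbhs.
  have e20 : 0 < e / 2 by rewrite divr_gt0.
  have [k _ /(_ k (leqnn k)) /= ke] := near_infty_natSinv_lt (PosNum e20).
  have qP i : exists q : rat, ball (x 0 i) k.+1%:R^-1 (ratr q : R).
    have [q] := @rat_in_itvoo R (x 0 i - k.+1%:R^-1) (x 0 i + k.+1%:R^-1)
      ltac:(by rewrite ltrBlDr -addrA ltrDl addr_gt0).
    by rewrite ball_itv => ?; exists q.
  pose c : 'rV[rat]_n * nat := (\row_i projT1 (cid (qP i)), k).
  have cx i : ball (x 0 i) k.+1%:R^-1 (ratr (c.1 0 i) : R).
    by rewrite mxE; case: cid.
  exists c => [y /= cy|i]; last exact/ball_sym/cx.
  apply: eU; split => // j i; rewrite !ord1 => {j}.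
  apply: (@le_ball _ _ _ (k.+1%:R^-1 + k.+1%:R^-1)).
    by rewrite [leRHS]splitr lerD// ltW.
  exact: ball_triangle (cx i) (cy i).
rewrite UE preimage_bigcup bigcup_mkcond.
apply: countable_bigcupT_measurable; first exact: countableP.
move=> c; case: ifPn => // _.
rewrite [X in measurable X](_ : _ =
    \bigcap_i (fun x => f x 0 i) @^-1` ball (ratr (c.1 0 i) : R) c.2.+1%:R^-1).
  apply: fin_bigcap_measurable => // i _; rewrite -[X in measurable X]setTI.
  by apply: mf => //; apply: open_measurable; exact: ball_open.
by apply/seteqP; split=> x /= cx i; [move=> _|]; exact: cx.
Qed.

Lemma measurable_coord n (i : 'I_n) :
  measurable_fun setT (fun x : 'rV[R]_n => x 0 i).
Proof.
apply: (measurability _ (RGenOpens.measurableE R)).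
move=> _ [_ [a [b ->]] <-]; rewrite setTI; apply: sub_sigma_algebra.
apply: open_comp; last exact: interval_open.
by move=> x _; exact: coord_continuous.
Qed.

Definition consr n (x : 'rV[R]_n * R) : 'rV[R]_n.+1 :=
  row_mx (const_mx x.2 : 'rV_1) x.1.

Lemma measurable_consr n : measurable_fun setT (@consr n).
Proof.
apply: measurable_fun_rV => i.
have [j ->|j ->] := @split_ordP 1 n i.
  rewrite (_ : (fun _ => _) = snd); first exact: measurable_snd.
  by apply/funext => x; rewrite /consr (@row_mxEl _ 1 1 n) mxE.
rewrite (_ : (fun _ => _) = (fun y : 'rV[R]_n => y 0 j) \o fst).
  by apply: measurableT_comp => //; exact: measurable_coord.
by apply/funext => x; rewrite /consr (@row_mxEr _ 1 1 n).
Qed.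

(* n-dimensional Lebesgue measure: the image under consr of the product of
   (n-1)-dimensional and one-dimensional Lebesgue measure *)
Fixpoint leb n : {measure set 'rV[R]_n -> \bar R} :=
  match n return {measure set 'rV[R]_n -> \bar R} with
  | 0 => dirac (0 : 'rV[R]_0)
  | m.+1 => measure_function_pushforward__canonical__measure_function_Measure
     (leb m \x @lebesgue_measure R)%E (@measurable_consr m)
  end.

Lemma lebS n (A : set 'rV[R]_n.+1) :
  leb n.+1 A = (leb n \x @lebesgue_measure R)%E (@consr n @^-1` A).
Proof. by []. Qed.

End lebesgue_vector.

Section L2.
Variables (R : realType) (n : nat) (D : set 'rV[R]_n).
Implicit Types f g h : 'rV[R]_n -> R.

(* Functions are total on R^n; only their values on D matter, and no quotient
   by almost everywhere equality is taken. *)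
Definition L2 : set ('rV[R]_n -> R) :=
  [set f | f \_ D \in Lfun (@leb R n) 2%:E].

Definition L2inner f g : R := \int[@leb R n]_(x in D) (f x * g x).

Definition L2norm f : R := Num.sqrt (L2inner f f).

Definition L2vinner m (v w : 'I_m -> 'rV[R]_n -> R) : R :=
  \sum_i L2inner (v i) (w i).

Definition L2tinner m (A B : 'I_m -> 'I_m -> 'rV[R]_n -> R) : R :=
  \sum_i L2vinner (A i) (B i).

Definition L2vnorm m (v : 'I_m -> 'rV[R]_n -> R) : R :=
  Num.sqrt (L2vinner v v).

Definition L2tnorm m (A : 'I_m -> 'I_m -> 'rV[R]_n -> R) : R :=
  Num.sqrt (L2tinner A A).

Definition L2_eq f g := {ae @leb R n, forall x, D x -> f x = g x}.

End L2.

Section smooth.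
Variables (R : realType) (n : nat).

Definition partial (i : 'I_n) (f : 'rV[R]_n -> R) : 'rV[R]_n -> R :=
  fun x => 'D_(delta_mx 0 i) f x.

Fixpoint Ck k (f : 'rV[R]_n -> R) : Prop :=
  continuous f /\
  (if k is k'.+1 then forall i,
     (forall x, derivable f x (delta_mx 0 i)) /\ Ck k' (partial i f)
   else True).

Definition smooth f := forall k, Ck k f.

(* C_c^oo(D) *)
Definition test_function (D : set 'rV[R]_n) (f : 'rV[R]_n -> R) :=
  smooth f /\
  exists K, [/\ compact K, K `<=` D & forall x, ~ K x -> f x = 0].

Definition weak_partial (D : set 'rV[R]_n) i (f g : 'rV[R]_n -> R) :=
  forall psi, test_function D psi ->
    L2inner D f (partial i psi) = - L2inner D g psi.
End smooth.


Section H1_closed.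
Variables (R : realType) (n : nat) (D : set 'rV[R]_n).

Lemma continuous_measurable_rV m (f : 'rV[R]_m -> R) :
  continuous f -> measurable_fun setT f.
Proof.
move=> cf; apply: (measurability _ (RGenOpens.measurableE R)).
move=> _ [_ [a [b ->]] <-]; rewrite setTI; apply: sub_sigma_algebra.
by apply: open_comp; [move=> x _; exact: cf|exact: interval_open].
Qed.


Let cube m (r : R) : set 'rV[R]_m := [set x | forall i, x 0 i \in `[-r, r]].

Let measurable_cube m r : measurable (@cube m r).
Proof.
rewrite [X in measurable X](_ : _ =
    \bigcap_i (fun x : 'rV[R]_m => x 0 i) @^-1` [set` `[-r, r]]).
  apply: fin_bigcap_measurable => // i _; rewrite -[X in measurable X]setTI.
  by apply: measurable_coord => //; exact: measurable_itv.
by apply/seteqP; split=> x /= cx i; [move=> _|]; exact: cx.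
Qed.

Let leb_cube m r : (leb R m (@cube m r) < +oo)%E.
Proof.
elim: m => [|m IH]; first by rewrite /= diracE ltey.
rewrite lebS; have -> : @consr R m @^-1` @cube m.+1 r =
    @cube m r `*` [set` `[-r, r]].
  apply/seteqP; split=> [[x a] /= ca|[x a] /= [cx ca] i].
    split=> [i|].
      by have := ca (rshift 1 i); rewrite /consr (@row_mxEr _ 1 1 m).
    by have := ca (lshift m (0 : 'I_1)); rewrite /consr (@row_mxEl _ 1 1 m) mxE.
  have [j ->|j ->] := @split_ordP 1 m i.
    by rewrite /consr (@row_mxEl _ 1 1 m) mxE.
  by rewrite /consr (@row_mxEr _ 1 1 m); exact: cx.
rewrite product_measure1E//; last exact: measurable_cube.
rewrite lte_mul_pinfty // ?measure_ge0 ?ge0_fin_numE ?measure_ge0//.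
by rewrite /= lebesgue_measure_itv/=; case: ifP => _; rewrite ltey.
Qed.

Lemma Lfun_compact_supp (psi : 'rV[R]_n -> R) (K : set 'rV[R]_n) :
  continuous psi -> compact K -> (forall x, ~ K x -> psi x = 0) ->
  psi \in Lfun (leb R n) 2%:E.
Proof.
move=> cpsi cK psi0.
have mpsi : measurable_fun setT psi by exact: continuous_measurable_rV.
have [M [_ KM]] : bounded_set K by exact: compact_bounded.
have [N [_ fN]] : bounded_set (psi @` K).
  apply: compact_bounded; apply: continuous_compact => //.
  exact: continuous_subspaceT.
pose r := M + 1; pose b := `|N| + 1.
pose Q := @cube n r.
have mQ : measurable Q by exact: measurable_cube.
have psiQ x : (`|psi x| `^ 2 <= b `^ 2 * \1_Q x).
  have [Kx|nKx] := pselect (K x); last first.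
    by rewrite psi0// normr0 powR0 ?pnatr_eq0// mulr_ge0 ?powR_ge0//.
  have Qx : Q x.
    move=> i; rewrite in_itv/= -ler_norml.
    have xr : `|x| <= r by apply: (KM r) => //; rewrite /r ltrDl.
    apply: le_trans xr; rewrite [leRHS]/Num.norm /= mx_normrE.
    by apply/bigmax_geP; right => /=; exists (0, i).
  rewrite indicE mem_set// mulr1 ge0_ler_powR ?nnegrE ?addr_ge0//.
  by apply: (fN b); [rewrite /b (le_lt_trans (ler_norm _))// ltrDl|exists x].
rewrite inE; apply/andP; split; rewrite inE//= /finite_norm unlock/=.
rewrite poweR_lty//.
apply: (@le_lt_trans _ _ (\int[leb R n]_x ((b `^ 2)%:E * (\1_Q x)%:E))%E).
  apply: ge0_le_integral => //=.
  - apply/measurable_EFinP.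
    apply/(@measurableT_comp _ _ _ _ _ _ (fun x : R => x `^ 2)%R) => //.
    exact/measurableT_comp.
  - by apply: measurable_funeM; apply/measurable_EFinP.
  by move=> x _; rewrite -EFinM lee_fin.
rewrite ge0_integralZl//.
- rewrite integral_indic// setIT lte_mul_pinfty ?lee_fin ?powR_ge0//.
  exact: leb_cube.
- exact/measurable_EFinP.
- by rewrite lee_fin powR_ge0.
Qed.

Let le12 : (1 <= 2%:E :> \bar R)%E. Proof. by rewrite lee_fin ler1n. Qed.

Let restrictDZ (a : R) (f g : 'rV[R]_n -> R) :
  (a *: f + g) \_ D = a *: (f \_ D) + g \_ D.
Proof.
apply/funext => x; rewrite /patch /= !fctE; case: ifP => // _.
by rewrite scaler0 addr0.
Qed.

Lemma L2_submod_closed : submod_closed (mem (L2 D)).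
Proof.
have [L0 LDZ] := Lfun_submod_closed (leb R n) le12.
split; rewrite ?inE /L2 /=.
  by rewrite (_ : 0 \_ D = 0)//; apply/funext => x; rewrite patchE if_same.
move=> a f g; rewrite !inE /L2 /= restrictDZ; exact: LDZ.
Qed.

Lemma L2innerDZ (a : R) (f g psi : 'rV[R]_n -> R) : L2 D f -> L2 D g ->
  psi \in Lfun (leb R n) 2%:E ->
  L2inner D (a *: f + g) psi = a * L2inner D f psi + L2inner D g psi.
Proof.
move=> L2f L2g L2psi; rewrite /L2inner.
have E h : \int[leb R n]_(x in D) (h x * psi x) =
    \int[leb R n]_x ((h \_ D) x * psi x).
  rewrite Rintegral_mkcond; congr Rintegral; apply/funext => x.
  by rewrite !patchE; case: ifP => // _; rewrite mul0r.
have I h : L2 D h ->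
    (leb R n).-integrable setT (EFin \o (fun x => (h \_ D) x * psi x)).
  by move=> L2h; apply/Lfun1_integrable; exact: Lfun2_mul_Lfun1.
rewrite !E restrictDZ -RintegralZl//; last exact: I.
rewrite -RintegralD//; last 2 first.
- exact: (integrableZl measurableT a (I f L2f)).
- exact: I.
congr Rintegral; apply/funext => x.
by rewrite !fctE mulrDl -mulrA.
Qed.

Lemma test_Lfun (psi : 'rV[R]_n -> R) : test_function D psi ->
  psi \in Lfun (leb R n) 2%:E /\
  forall i, partial i psi \in Lfun (leb R n) 2%:E.
Proof.
move=> [spsi [K [cK KD psi0]]]; split=> [|i].
  by apply: (Lfun_compact_supp _ cK) => //; have [] := spsi 0.
have [_ /(_ i)[_ [cp _]]] := spsi 1.
apply: (Lfun_compact_supp _ cK) => // x nKx.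
have oK : open (~` K).
  by rewrite openC; apply: compact_closed => //; exact: norm_hausdorff.
rewrite /partial (@near_eq_derive _ _ _ _ (cst 0)) ?derive_cst//.
by apply: filterS (open_nbhs_nbhs (conj oK nKx)) => y; exact: psi0.
Qed.

(* An element of H^1(D) is a pair (v, grad v) of a representative v and a
   representative of its weak gradient; the pairs form a submodule, so that H1
   is an lmodType with componentwise operations. *)
Definition H1pred : {pred ('rV[R]_n -> R) * ('I_n -> 'rV[R]_n -> R)} :=
  fun w => `[< L2 D w.1 /\
               forall i, L2 D (w.2 i) /\ weak_partial D i w.1 (w.2 i) >].

Lemma H1_submod_closed : submod_closed H1pred.
Proof.
have [L0 LDZ] := L2_submod_closed.
have L2_0 : L2 D 0 by move: L0; rewrite inE.
have L2DZ a f g : L2 D f -> L2 D g -> L2 D (a *: f + g).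
  by move=> Lf Lg; have := LDZ a f g; rewrite !inE; apply.
split.
  apply/asboolP; split=> // i; split=> // psi _.
  suff inner0 h : L2inner D 0 h = 0 by rewrite !inner0 oppr0.
  rewrite /L2inner /Rintegral (_ : (fun _ => _) = cst 0%E) ?integral0//.
  by apply/funext => x; rewrite mul0r.
move=> a v w /asboolP[Lv Dv] /asboolP[Lw Dw].
apply/asboolP; split=> [|i]; first exact: L2DZ.
have [Lvi dv] := Dv i; have [Lwi dw] := Dw i.
split=> [|psi tpsi]; first exact: L2DZ.
have [Lpsi /(_ i) Lpartial] := test_Lfun tpsi.
by rewrite !L2innerDZ// dv// dw// mulrN opprD.
Qed.

HB.instance Definition _ := GRing.isSubmodClosed.Build _ _ H1pred
  H1_submod_closed.

Record H1 := MkH1 {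
  H1pair : ('rV[R]_n -> R) * ('I_n -> 'rV[R]_n -> R) ;
  _ : H1pair \in H1pred }.

HB.instance Definition _ := [isSub for H1pair].
HB.instance Definition _ := gen_eqMixin H1.
HB.instance Definition _ := gen_choiceMixin H1.
HB.instance Definition _ := [SubChoice_isSubLmodule of H1 by <:].

Definition H1fun (v : H1) : 'rV[R]_n -> R := (H1pair v).1.
Definition grad (v : H1) : 'I_n -> 'rV[R]_n -> R := (H1pair v).2.

Definition H1_eq (v w : H1) :=
  L2_eq D (H1fun v) (H1fun w) /\ forall i, L2_eq D (grad v i) (grad w i).

Definition eps (v : 'I_n -> H1) (i j : 'I_n) : 'rV[R]_n -> R :=
  fun x => 2^-1 * (grad (v i) j x + grad (v j) i x).

Definition div (v : 'I_n -> H1) : 'rV[R]_n -> R :=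
  fun x => \sum_i grad (v i) i x.

(* |v|_1, for vector fields *)
Definition H1_seminorm (v : 'I_n -> H1) : R :=
  L2tnorm D (fun i => grad (v i)).

Definition vH1_eq (v w : 'I_n -> H1) := forall i, H1_eq (v i) (w i).

End H1_closed.
Coercion H1fun : H1 >-> Funclass.

Section geometry.
Variables (R : realType) (d : nat).
Implicit Types (S : set 'rV[R]_d).

(* convex hull of the vertices V i, i \in A *)
Definition face n (V : 'I_n.+1 -> 'rV[R]_d) (A : {set 'I_n.+1}) : set 'rV[R]_d :=
  [set x | exists c : 'I_n.+1 -> R,
    [/\ forall i, 0 <= c i, forall i, i \notin A -> c i = 0,
        \sum_i c i = 1 & x = \sum_i c i *: V i]].

Definition simplex n (V : 'I_n.+1 -> 'rV[R]_d) := face V [set: 'I_n.+1]%SET.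

Definition edge_mx n (V : 'I_n.+1 -> 'rV[R]_d) : 'M[R]_(n, d) :=
  \matrix_i (V (lift ord0 i) - V ord0).

Record simplices (n : nat) := MkSimplices {
  ncells : nat ;
  cell : 'I_ncells -> 'I_n.+1 -> 'rV[R]_d }.
Arguments cell {n} K : rename.

(* The cells are nondegenerate n-simplices, pairwise distinct, and two of them
   meet in a (possibly empty) common proper face. *)
Definition triangulation_of n (K : simplices n) S :=
  [/\ forall i, row_free (edge_mx (cell K i)),
      forall i j, i != j -> exists A B : {set 'I_n.+1},
        [/\ A != [set: 'I_n.+1]%SET, B != [set: 'I_n.+1]%SET,
            simplex (cell K i) `&` simplex (cell K j) = face (cell K i) A &
            simplex (cell K i) `&` simplex (cell K j) = face (cell K j) B] &
      \bigcup_i simplex (cell K i) = S].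

Definition boundary S := closure S `\` S°.

(* The boundary is a finite union of (d-1)-simplices: segments for d = 2,
   triangles for d = 3. dom_regular says that Omega lies on one side of its
   boundary (no slits). *)
Record polytopal_domain := MkPolytopalDomain {
  dom :> set 'rV[R]_d ;
  facets : simplices d.-1 ;
  dom_open : open dom ;
  dom_bounded : bounded_set dom ;
  dom_connected : connected dom ;
  dom_regular : (closure dom)° = dom ;
  dom_boundary : triangulation_of facets (boundary dom) }.

Definition ref_simplex n : set 'rV[R]_n :=
  [set s | (forall i, 0 <= s 0 i) /\ \sum_i s 0 i <= 1].

Definition facet_param n (V : 'I_n.+1 -> 'rV[R]_d) (s : 'rV[R]_n) : 'rV[R]_d :=
  V ord0 + s *m edge_mx V.

(* The image under facet_param of Lebesgue measure on ref_simplex, times this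
   factor, is the n-dimensional surface measure of the simplex. *)
Definition gram n (V : 'I_n.+1 -> 'rV[R]_d) : R :=
  Num.sqrt (\det (edge_mx V *m (edge_mx V)^T)).

Section boundary_integral.
Variables (Omega : polytopal_domain) (G : set 'rV[R]_d).
Local Notation facet := (cell (facets Omega)).
Implicit Types f g : 'rV[R]_d -> R.

Definition facet_piece i : set 'rV[R]_d.-1 :=
  @ref_simplex d.-1 `&` facet_param (facet i) @^-1` G.

Definition surface_measure : \bar R :=
  (\sum_i (gram (facet i))%:E * leb R d.-1 (facet_piece i))%E.

Definition bL2 f := forall i, L2 (facet_piece i) (f \o facet_param (facet i)).

Definition binner f g : R := \sum_i gram (facet i) *
  L2inner (facet_piece i) (f \o facet_param (facet i))
                          (g \o facet_param (facet i)).

Definition bnorm f : R := Num.sqrt (binner f f).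

End boundary_integral.

Definition enorm (x : 'rV[R]_d) : R := Num.sqrt (\sum_i x 0 i ^+ 2).

Definition diameter S : R :=
  sup [set r | exists x y, [/\ S x, S y & r = enorm (x - y)]].

(* diameter of the largest ball contained in S *)
Definition inball_diameter S : R :=
  sup [set r | exists c, [set y | enorm (y - c) <= r / 2] `<=` S].

Definition mesh_size (K : simplices d) : R :=
  \big[Num.max/0]_i diameter (simplex (cell K i)).

Definition regular_family (I : Type) (M : I -> simplices d) :=
  exists2 sigma, 0 < sigma & forall m i,
    diameter (simplex (cell (M m) i)) <=
    sigma * inball_diameter (simplex (cell (M m) i)).

Definition quasi_uniform_family (I : Type) (M : I -> simplices d) :=
  exists2 tau, 0 < tau & forall m i,
    mesh_size (M m) <= tau * diameter (simplex (cell (M m) i)).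

(* polynomials of total degree at most m *)
Definition polyfun (m : nat) : set ('rV[R]_d -> R) :=
  [set f | exists c : {ffun 'I_d -> 'I_m.+1} -> R,
    f = fun x : 'rV[R]_d =>
      \sum_(a : {ffun 'I_d -> 'I_m.+1} | (\sum_i a i <= m)%N)
        c a * \prod_i x 0 i ^+ a i].

Record mixed_domain := MkMixedDomain {
  mdom :> polytopal_domain ;
  GammaD : set 'rV[R]_d ;
  GammaN : set 'rV[R]_d ;
  GammaD_closed : closed GammaD ;
  GammaN_closed : closed GammaN ;
  Gamma_disjoint : GammaD `&` GammaN = set0 ;
  Gamma_cover : GammaD `|` GammaN = boundary mdom ;
  GammaD_pos : surface_measure mdom GammaD != 0%E }.

End geometry.
Arguments cell {R d n} K : rename.

Section spaces.
Variables (R : realType) (d : nat) (Omega : mixed_domain R d).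
Local Notation pt := 'rV[R]_d.
Local Notation H1 := (H1 Omega).
Local Notation vH1 := ('I_d -> H1).

(* The trace is the closure of the restriction to the boundary of functions
   smooth up to the boundary, from H^1(Omega) to L^2(boundary). *)
Definition is_trace (v : H1) (g : pt -> R) :=
  bL2 Omega (boundary Omega) g /\
  exists w : nat -> pt -> R,
    [/\ forall m, smooth (w m),
        L2norm Omega ((v : pt -> R) - w m) @[m --> \oo] --> (0 : R),
        forall i, L2norm Omega (grad v i - partial i (w m))
          @[m --> \oo] --> (0 : R) &
        bnorm Omega (boundary Omega) (g - w m) @[m --> \oo] --> (0 : R)].

Definition trace (v : H1) : pt -> R := xget 0 [set g | is_trace v g].

Definition H1_0D : set H1 := [set v | exists2 g, is_trace v g &
  bnorm Omega (GammaD Omega) g = 0].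

Definition vH1_0D : set vH1 := [set v | forall i, H1_0D (v i)].

(* <g, v>_{Gamma_N} *)
Definition binnerN (g : pt -> R) (v : H1) : R :=
  binner Omega (GammaN Omega) g (trace v).

Definition vbinnerN (g : 'I_d -> pt -> R) (v : vH1) : R :=
  \sum_i binnerN (g i) (v i).

Definition conforming_space (m : nat) (K : simplices R d d) : set H1 :=
  [set v | [/\ H1_0D v, {in dom Omega, continuous (v : pt -> R)} &
    forall c, exists2 f, polyfun m f &
      forall x, dom Omega x -> simplex (cell K c) x -> v x = f x]].

Definition U_h k K : set vH1 := [set v | forall i, conforming_space k K (v i)].

Definition P_h k K : set H1 := conforming_space k.-1 K.

(* Up to null sets, since q has no prescribed value on the interfaces. *)
Definition Z_h (l : nat) (K : simplices R d d) : set (pt -> R) :=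
  [set q | L2 Omega q /\ forall c, exists2 f, polyfun l f &
    {ae leb R d, forall x, simplex (cell K c) x -> q x = f x}].

Definition inf_sup (C0 : R) (U : set vH1) (Z : set (pt -> R)) :=
  forall w, Z w -> ((C0 * L2norm Omega w)%R%:E <=
    ereal_sup [set r | exists v, [/\ U v, ~ vH1_eq v (fun=> 0%R) &
      r = (L2inner Omega w (div v) / H1_seminorm v)%R%:E]])%E.

(* The projections act on elements of H^1 and L^2, i.e. up to almost everywhere
   equality: that is the second clause of the next two definitions. *)
Definition stokes_projection mu (U : set vH1) (Z : set (pt -> R))
    (Qu : vH1 -> (pt -> R) -> vH1) (Qq : vH1 -> (pt -> R) -> pt -> R) :=
  (forall u q, vH1_0D u -> L2 Omega q ->
    [/\ U (Qu u q), Z (Qq u q),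
        forall v, U v ->
          2 * mu * L2tinner Omega (eps (Qu u q)) (eps v)
          - L2inner Omega (Qq u q) (div v) =
          2 * mu * L2tinner Omega (eps u) (eps v) - L2inner Omega q (div v) &
        forall w, Z w ->
          L2inner Omega w (div (Qu u q)) = L2inner Omega w (div u)]) /\
  (forall u u' q q', vH1_0D u -> vH1_0D u' -> L2 Omega q -> L2 Omega q' ->
    vH1_eq u u' -> L2_eq Omega q q' ->
    vH1_eq (Qu u q) (Qu u' q') /\ L2_eq Omega (Qq u q) (Qq u' q')).

Definition elliptic_projection (P : set H1) (Qp : H1 -> H1) :=
  (forall p, H1_0D p -> P (Qp p) /\ forall w, P w ->
    L2vinner Omega (grad (Qp p)) (grad w) = L2vinner Omega (grad p) (grad w)) /\
  (forall p p', H1_0D p -> H1_0D p' -> H1_eq p p' -> H1_eq (Qp p) (Qp p')).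

(* f belongs to C([0, T]; L^2(Omega)) and ft t is its derivative, in the norm of
   L^2(Omega), at every t in (0, T] (one-sided at T). *)
Definition time_derivative (T : R) (f ft : R -> pt -> R) :=
  [/\ forall t, 0 <= t <= T -> L2 Omega (f t),
      forall t, 0 <= t <= T ->
        L2norm Omega (f s - f t) @[s --> within `[0, T] (nbhs t)] --> (0 : R) &
      forall t, 0 < t <= T -> L2 Omega (ft t) /\
        L2norm Omega ((s - t)^-1 *: (f s - f t) - ft t)
          @[s --> within `[0, T] t^'] --> (0 : R)].

Definition admissible_data (T : R) (f : R -> 'I_d -> pt -> R) (g : R -> pt -> R)
    (beta : R -> 'I_d -> pt -> R) (gamma : R -> pt -> R) :=
  forall t, 0 < t <= T ->
    [/\ forall i, L2 Omega (f t i), L2 Omega (g t),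
        forall i, bL2 Omega (GammaN Omega) (beta t i) &
        bL2 Omega (GammaN Omega) (gamma t)].

Section three_field.
Variables (mu lambda kappa T : R).
Variables (f : R -> 'I_d -> pt -> R) (g : R -> pt -> R).
Variables (beta : R -> 'I_d -> pt -> R) (gamma : R -> pt -> R).
Variables (varphi : vH1) (phi : H1).

(* dq and dp stand for the time derivatives of q and p. *)
Definition three_field_equations (U : set vH1) (Z : set (pt -> R)) (P : set H1)
    (u : R -> vH1) (q : R -> pt -> R) (p : R -> H1) (dq dp : R -> pt -> R) :=
  forall t, 0 < t <= T ->
  [/\ forall v, U v ->
        2 * mu * L2tinner Omega (eps (u t)) (eps v)
        - L2inner Omega (q t) (div v) =
        L2vinner Omega (f t) (fun i => v i) + vbinnerN (beta t) v,
      forall w, Z w ->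
        L2inner Omega (lambda^-1 *: (q t - (p t : pt -> R))) w
        + L2inner Omega (div (u t)) w = 0 &
      forall w, P w ->
        - L2inner Omega (lambda^-1 *: (dq t - dp t)) w
        + kappa * L2vinner Omega (grad (p t)) (grad w) =
        L2inner Omega (g t) w + binnerN (gamma t) w].

(* - lambda div varphi + phi *)
Definition q0 : pt -> R := - (lambda *: div varphi) + (phi : pt -> R).

Definition weak_solution u q p (dq dp : R -> pt -> R) :=
  [/\ forall t, 0 <= t <= T -> [/\ vH1_0D (u t), L2 Omega (q t) & H1_0D (p t)],
      time_derivative T q dq /\ time_derivative T (fun t => p t : pt -> R) dp,
      [/\ vH1_eq (u 0) varphi, H1_eq (p 0) phi & L2_eq Omega (q 0) q0] &
      three_field_equations vH1_0D (L2 Omega) H1_0D u q p dq dp].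

Definition semidiscrete_solution (U : set vH1) (Z : set (pt -> R)) (P : set H1)
    Qu Qq Qp u q p (dq dp : R -> pt -> R) :=
  [/\ forall t, 0 <= t <= T -> [/\ U (u t), Z (q t) & P (p t)],
      time_derivative T q dq /\ time_derivative T (fun t => p t : pt -> R) dp,
      [/\ vH1_eq (u 0) (Qu varphi q0), L2_eq Omega (q 0) (Qq varphi q0) &
          H1_eq (p 0) (Qp phi)] &
      three_field_equations U Z P u q p dq dp].

End three_field.
End spaces.
Arguments U_h {R d} Omega k K _.
Arguments P_h {R d} Omega k K _.
Arguments conforming_space {R d} Omega m K _.
Arguments H1_0D {R d} Omega _.
Arguments vH1_0D {R d} Omega _.

(* Main.v *)
Require Import Defs.
From mathcomp Require Import all_boot all_order all_algebra.
From mathcomp Require Import all_classical all_reals all_analysis.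
From mathcomp Require Import measurable_realfun ring lra.
Import Order.TTheory GRing.Theory Num.Theory.
Import numFieldNormedType.Exports.
Local Open Scope classical_set_scope.
Local Open Scope ring_scope.

(** The errors are split as e = eta + x, where eta is the projection error and
    x = (xu, xq, xp) is the difference between the projection of the solution and
    the scheme. The data cancel between the continuous and the discrete problem,
    and the orthogonality relations of the projections remove eta from the
    equations, except for eta' = d/dt (eta_q - eta_p):

      2 mu (eps xu, eps v) = (xq, div v),
      (div xu, w) = - (r, w) / lambda,
      kappa (grad xp, grad w) = (r', w) / lambda,

    where r = e_q - e_p, so that r' = xq' - xp' + eta'. Testing the first two
    equations, differentiated in time, with xq, and the third with xp, gives

      d/dt (mu |eps xu|^2 + |xq - xp|^2 / (2 lambda)) + kappa |grad xp|^2
        = - (eta', xq - xp) / lambda,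

    and Gronwall's inequality bounds mu |eps xu|^2 by the integral of |eta'|^2
    (energy_estimate_u). Testing instead with the time derivatives gives
    2 mu |eps xu'|^2 = - (r', xq') / lambda, hence

      d/dt (kappa |grad xp|^2) / 2 = (r', xp') / lambda
        <= - (r', xq' - xp') / lambda <= |eta'|^2 / (4 lambda)

    (energy_estimate_p). Finally the inf-sup condition bounds |xq| by
    2 mu |eps xu| / C0 (inf_sup_bound).

    Three points make this rigorous under the given regularity. First, only q and
    p are differentiable in time, and only in L^2; therefore the equations are not
    differentiated but written for difference quotients. Combining the first two
    equations gives 2 mu lambda (eps (xu s), eps (xu t)) = - (r t, xq s), which
    provides the increments of |eps xu|^2 without a derivative of xu.

    Second, the gradient of xp is not assumed continuous in time. The elements
    P_h are finite-dimensional, so that |grad w| <= K |w| along the curve xp, with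
    K depending on the mesh (curve_inverse_inequality); K only serves to
    show that |grad xp|^2 has the expected one-sided derivative, and does not
    enter the final estimate.

    Third, the two energies are continuous functions with a right derivative at
    every point, and this derivative is bounded by an integrable function without
    being known to be integrable itself. That their increments are nevertheless
    bounded by the integral of the majorant (increment_le_integral) uses an
    approximation of the majorant from above by sums of indicators of open sets
    (open_majorant). The majorant |eta'|^2 is measurable as a limit of difference
    quotients (measurable_derivative). *)

Set Implicit Arguments.
Unset Strict Implicit.
Unset Printing Implicit Defensive.

(** * Semi-inner products *)

(** Functions are not identified almost everywhere, so the forms below are only
    positive semi-definite; and the L^2 form is bilinear only on the square
    integrable functions, a subset [S] of the space of all functions. *)
Record semi_inner (R : realType) (V : lmodType R) (S : set V)
    (b : V -> V -> R) : Prop := SemiInner {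
  si_closed : forall a x y, S x -> S y -> S (a *: x + y) ;
  si_linear : forall a x y z, S x -> S y -> S z ->
    b (a *: x + y) z = a * b x z + b y z ;
  si_sym : forall x y, b x y = b y x ;
  si_ge0 : forall x, 0 <= b x x }.

Definition nrm (R : realType) (V : lmodType R) (b : V -> V -> R) (x : V) : R :=
  Num.sqrt (b x x).

Section semi_inner_theory.
Variables (R : realType) (V : lmodType R) (S : set V) (b : V -> V -> R).
Hypothesis hb : semi_inner S b.
Implicit Types x y z : V.

Lemma si_memD x y : S x -> S y -> S (x + y).
Proof. by move=> Sx Sy; rewrite -[x]scale1r; exact: (si_closed hb). Qed.

Lemma si_memB x y : S x -> S y -> S (x - y).
Proof. by move=> Sx Sy; rewrite addrC -scaleN1r; exact: (si_closed hb). Qed.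

Lemma si_memZ (a : R) x : S x -> S (a *: x).
Proof.
move=> Sx; rewrite -[a](subrK 1) scalerDl scale1r; exact: (si_closed hb).
Qed.

Lemma siDl x y z : S x -> S y -> S z -> b (x + y) z = b x z + b y z.
Proof.
by move=> Sx Sy Sz; have := si_linear hb 1 Sx Sy Sz; rewrite scale1r mul1r.
Qed.

Lemma siBl x y z : S x -> S y -> S z -> b (x - y) z = b x z - b y z.
Proof.
move=> Sx Sy Sz; have := si_linear hb (-1) Sy Sx Sz.
by rewrite scaleN1r mulN1r addrC [RHS]addrC.
Qed.

Lemma siZl (a : R) x z : S x -> S z -> b (a *: x) z = a * b x z.
Proof.
move=> Sx Sz; have := si_linear hb (a - 1) Sx Sx Sz.
by rewrite -[X in _ *: x + X]scale1r -scalerDl subrK => ->; ring.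
Qed.

Lemma siDr x y z : S x -> S y -> S z -> b z (x + y) = b z x + b z y.
Proof. by move=> Sx Sy Sz; rewrite (si_sym hb) siDl// !(si_sym hb z). Qed.

Lemma siBr x y z : S x -> S y -> S z -> b z (x - y) = b z x - b z y.
Proof. by move=> Sx Sy Sz; rewrite (si_sym hb) siBl// !(si_sym hb z). Qed.

Lemma siZr (a : R) x z : S x -> S z -> b z (a *: x) = a * b z x.
Proof. by move=> Sx Sz; rewrite (si_sym hb) siZl// (si_sym hb z). Qed.

Lemma siDD x y : S x -> S y ->
  b (x + y) (x + y) = b x x + 2 * b x y + b y y.
Proof.
move=> Sx Sy; have Sxy := si_memD Sx Sy.
by rewrite siDl// !siDr// (si_sym hb y x); ring.
Qed.

Lemma siBB x y : S x -> S y ->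
  b (x - y) (x - y) = b x x - 2 * b x y + b y y.
Proof.
move=> Sx Sy; have Sxy := si_memB Sx Sy.
by rewrite siBl// !siBr// (si_sym hb y x); ring.
Qed.

Lemma cauchy_schwarz_sqr x y : S x -> S y -> b x y ^+ 2 <= b x x * b y y.
Proof.
move=> Sx Sy; have x0 := si_ge0 hb x; have y0 := si_ge0 hb y.
have pos t : 0 <= b x x - 2 * t * b x y + t ^+ 2 * b y y.
  rewrite (_ : _ + _ = b (x - t *: y) (x - t *: y)); first exact: (si_ge0 hb).
  have Sty := si_memZ t Sy.
  by rewrite siBB// siZl// siZr// siZr//; ring.
have [yy0|yy0] := eqVneq (b y y) 0; last first.
  have {}y0 : 0 < b y y by rewrite lt_neqAle eq_sym yy0.
  have := pos (b x y / b y y).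
  have -> : b x x - 2 * (b x y / b y y) * b x y + (b x y / b y y) ^+ 2 * b y y =
      (b x x * b y y - b x y ^+ 2) / b y y by field.
  by rewrite pmulr_lge0 ?invr_gt0// subr_ge0.
have [->|xy0] := eqVneq (b x y) 0; first by rewrite expr0n mulr_ge0.
have := pos ((b x x + 1) / (2 * b x y)); rewrite yy0.
have -> : b x x - 2 * ((b x x + 1) / (2 * b x y)) * b x y +
  ((b x x + 1) / (2 * b x y)) ^+ 2 * 0 = - 1 by field.
by rewrite oppr_ge0 ler10.
Qed.

Lemma nrm_ge0 x : 0 <= nrm b x. Proof. exact: sqrtr_ge0. Qed.

Lemma nrm_sqr x : nrm b x ^+ 2 = b x x.
Proof. by rewrite sqr_sqrtr// (si_ge0 hb). Qed.

Lemma cauchy_schwarz x y : S x -> S y -> `|b x y| <= nrm b x * nrm b y.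
Proof.
move=> Sx Sy; rewrite -sqrtrM ?(si_ge0 hb)// -sqrtr_sqr.
exact/ler_wsqrtr/cauchy_schwarz_sqr.
Qed.

Lemma le_si x y : S x -> S y -> b x y <= nrm b x * nrm b y.
Proof. by move=> Sx Sy; exact: le_trans (ler_norm _) (cauchy_schwarz Sx Sy). Qed.

Lemma nrmD x y : S x -> S y -> nrm b (x + y) <= nrm b x + nrm b y.
Proof.
move=> Sx Sy; have x0 := nrm_ge0 x; have y0 := nrm_ge0 y.
rewrite -(@ler_pXn2r _ 2) ?nnegrE ?nrm_ge0 ?addr_ge0//.
rewrite nrm_sqr siDD// -!nrm_sqr; have := le_si Sx Sy; lra.
Qed.

Lemma nrmZ (a : R) x : S x -> nrm b (a *: x) = `|a| * nrm b x.
Proof.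
move=> Sx; have Sax := si_memZ a Sx.
rewrite /nrm siZl// siZr// mulrA -expr2.
by rewrite sqrtrM ?sqr_ge0// sqrtr_sqr.
Qed.

Lemma nrmBC x y : S x -> S y -> nrm b (x - y) = nrm b (y - x).
Proof.
by move=> Sx Sy; rewrite /nrm !siBB// (si_sym hb y x) addrAC [in RHS]addrAC [b x x + _]addrC.
Qed.

Lemma nrmB x y : S x -> S y -> nrm b (x - y) <= nrm b x + nrm b y.
Proof.
move=> Sx Sy; have := nrmD Sx (si_memZ (-1) Sy).
by rewrite nrmZ// scaleN1r normrN1 mul1r.
Qed.

Lemma ler_nrmB x y : S x -> S y -> `|nrm b x - nrm b y| <= nrm b (x - y).
Proof.
move=> Sx Sy; have := nrmD (si_memB Sx Sy) Sy; rewrite subrK => xy.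
have := nrmD (si_memB Sy Sx) Sx; rewrite subrK (nrmBC Sy Sx) => yx.
by rewrite ler_norml; apply/andP; split; lra.
Qed.

Lemma si_null_l x y : S x -> S y -> b x x = 0 -> b x y = 0.
Proof.
move=> Sx Sy x0; apply/eqP; rewrite -sqrf_eq0 eq_le sqr_ge0 andbT.
by have := cauchy_schwarz_sqr Sx Sy; rewrite x0 mul0r.
Qed.

Lemma siDD_le x y : S x -> S y ->
  b (x + y) (x + y) <= 2 * b x x + 2 * b y y.
Proof.
move=> Sx Sy; have := si_ge0 hb (x - y); rewrite siBB// siDD//; lra.
Qed.

Lemma cvg_si (I : Type) (F : set_system I) {FF : Filter F} (f g : I -> V) x y :
  S x -> S y -> (\forall i \near F, S (f i)) -> (\forall i \near F, S (g i)) ->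
  nrm b (f i - x) @[i --> F] --> (0 : R) ->
  nrm b (g i - y) @[i --> F] --> (0 : R) ->
  b (f i) (g i) @[i --> F] --> b x y.
Proof.
move=> Sx Sy Sf Sg fx gy.
have major : nrm b (f i - x) * nrm b (g i - y) + nrm b (f i - x) * nrm b y +
    nrm b x * nrm b (g i - y) @[i --> F] --> (0 : R).
  have := cvgD (cvgD (cvgM fx gy) (cvgM fx (cvg_cst (nrm b y))))
    (cvgM (cvg_cst (nrm b x)) gy).
  by rewrite !(mul0r, mulr0, addr0); apply.
apply/cvgrPdist_lt => e e0.
move/cvgrPdist_lt : major => /(_ _ e0); apply: filterS3 Sf Sg => i Sfi Sgi.
have Sfx := si_memB Sfi Sx; have Sgy := si_memB Sgi Sy.
rewrite sub0r normrN; apply: le_lt_trans.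
have -> : b x y - b (f i) (g i) =
    - (b (f i - x) (g i - y) + b (f i - x) y + b x (g i - y)).
  by rewrite siBl// !siBr// siBl//; ring.
rewrite normrN; apply: le_trans (ler_norm _).
apply: le_trans (ler_normD _ _) _; apply: lerD; last exact: cauchy_schwarz.
by apply: le_trans (ler_normD _ _) _; apply: lerD; exact: cauchy_schwarz.
Qed.

Lemma cvg_nrm (I : Type) (F : set_system I) {FF : Filter F} (f : I -> V) x :
  S x -> (\forall i \near F, S (f i)) ->
  nrm b (f i - x) @[i --> F] --> (0 : R) -> nrm b (f i) @[i --> F] --> nrm b x.
Proof.
move=> Sx Sf fx; apply/cvgrPdist_lt => e e0.
move/cvgrPdist_lt : fx => /(_ _ e0); apply: filterS2 Sf => i Sfi.
rewrite sub0r normrN; apply: le_lt_trans; rewrite distrC.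
exact: le_trans (ler_nrmB Sfi Sx) (ler_norm _).
Qed.

Lemma cvg_nrmB (I : Type) (F : set_system I) {FF : Filter F} (f g : I -> V) :
  (\forall i \near F, S (f i)) -> (\forall i \near F, S (g i)) ->
  nrm b (f i) @[i --> F] --> (0 : R) -> nrm b (g i) @[i --> F] --> (0 : R) ->
  nrm b (f i - g i) @[i --> F] --> (0 : R).
Proof.
move=> Sf Sg f0 g0.
apply: (@squeeze_cvgr _ _ _ _ (cst 0) (fun i => nrm b (f i) + nrm b (g i))).
- by apply: filterS2 Sf Sg => i Sfi Sgi; rewrite nrm_ge0/=; exact: nrmB.
- exact: cvg_cst.
- by rewrite -(addr0 0); exact: cvgD.
Qed.

End semi_inner_theory.

(** * Increments bounded by the integral of a majorant of the derivative *)

(** Continuity of [E] pushes the set of points up to which the inequality holds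
    to its supremum (where [Psi], being monotone, can only jump upwards), and
    the local hypothesis pushes it beyond. *)
Lemma le_increment (R : realType) (E Psi : R -> R) (a b : R) : a < b ->
  (forall x, a <= x <= b -> E s @[s --> within `[a, b] (nbhs x)] --> E x) ->
  (forall x y, a <= x -> x <= y -> y <= b -> Psi x <= Psi y) ->
  (forall x, a < x < b -> \forall y \near x^'+, E y - E x <= Psi y - Psi x) ->
  E b - E a <= Psi b - Psi a.
Proof.
move=> ab cE ndPsi loc.
have close x : a <= x <= b -> forall e, 0 < e -> exists2 r, 0 < r &
    forall y, a <= y <= b -> `|x - y| < r -> `|E x - E y| < e.
  move=> xab e e0; have /cvgrPdist_lt /(_ _ e0) := cE x xab.
  rewrite near_withinE => /nbhs_ballP[r /= r0 rE]; exists r => // y yab xy.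
  by apply: rE => //=; rewrite in_itv.
have main c : a < c -> c < b -> E b - E c <= Psi b - Psi c.
  move=> ac cb.
  pose S := [set y | c <= y <= b /\ E y - E c <= Psi y - Psi c].
  have Sc : S c by split; [rewrite lexx ltW|rewrite !subrr].
  have Sub : has_sup S.
    by split; [exists c|exists b; move=> y [/andP[]]].
  have cs : c <= sup S by apply: ub_le_sup => //; case: Sub.
  have sb : sup S <= b by apply: ge_sup; [exists c|move=> y [/andP[]]].
  have sab : a <= sup S <= b by rewrite sb andbT (le_trans (ltW ac)).
  have Ss : E (sup S) - E c <= Psi (sup S) - Psi c.
    apply/ler_addgt0Pr => e e0.
    have [r r0 rE] := close _ sab _ e0.
    have [y [/andP[cy yb] Ey] sy] := sup_adherent r0 Sub.
    have ys : y <= sup S by apply: ub_le_sup; [case: Sub|split=> //; rewrite cy].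
    have := rE y; rewrite yb (le_trans (ltW ac) cy) => /(_ isT).
    rewrite ger0_norm ?subr_ge0// ltrBlDr -ltrBlDl => /(_ sy).
    rewrite ltr_norml => /andP[_ Esy].
    have Psiy : Psi y <= Psi (sup S).
      by apply: ndPsi => //; exact: le_trans (ltW ac) cy.
    lra.
  have [sbE|sltb] := eqVneq (sup S) b; first by rewrite -sbE.
  have {}sltb : sup S < b by rewrite lt_neqAle sltb.
  have scab : a < sup S < b by rewrite sltb andbT (lt_le_trans ac).
  have [y [/= Ey [sy yb]]] : exists y,
      E y - E (sup S) <= Psi y - Psi (sup S) /\ sup S < y /\ y <= b.
    near (sup S)^'+ => y; exists y; split; [|split].
    - by near: y; exact: loc.
    - by near: y; exact: nbhs_right_gt.
    - by near: y; exact: nbhs_right_le.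
  suff : y <= sup S by rewrite leNgt sy.
  apply: ub_le_sup; first by case: Sub.
  by split; [rewrite yb andbT (le_trans cs)// ltW|lra].
apply/ler_addgt0Pr => e e0.
have [|r r0 rE] := close a _ _ e0; first by rewrite lexx ltW.
pose c := Num.min ((a + b) / 2) (a + r / 2).
have ac : a < c by rewrite lt_min; apply/andP; split; lra.
have cb : c < b by rewrite gt_min; apply/orP; left; lra.
have := rE c; rewrite (ltW ac) (ltW cb) => /(_ isT).
have car : c - a < r.
  by rewrite ltrBlDl gt_min; apply/orP; right; lra.
rewrite distrC ger0_norm ?subr_ge0 ?(ltW ac)// distrC => /(_ car).
rewrite ltr_norml => /andP[_ Ec].
have := main c ac cb; have := ndPsi a c (lexx _) (ltW ac) (ltW cb).
lra.
Unshelve. all: by end_near. Qed.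

(** The Vitali-Caratheodory approximation from above: [psi] is a countable sum of
    multiples of indicators of open sets, hence its lower bounds are local.
    Cutting the range of [phi] into slices of height [h], the level sets
    [A n] are covered by open sets [V n] of almost the same measure. *)
Lemma open_majorant (R : realType) (phi : R -> R) (a b e : R) : a < b -> 0 < e ->
  measurable_fun `]a, b[ phi -> (forall x, a < x < b -> 0 <= phi x) ->
  exists psi : R -> \bar R, exists2 h, 0 < h &
  [/\ measurable_fun setT psi, forall x, (0 <= psi x)%E,
      forall x, a < x < b -> \forall y \near x, ((phi x + h)%:E <= psi y)%E &
      (\int[lebesgue_measure]_(x in `]a, b]) psi x <=
       \int[lebesgue_measure]_(x in `]a, b[) (phi x)%:E + e%:E)%E].
Proof.
move=> ab e0 mphi phi0.
pose mu : {measure set (measurableTypeR R) -> \bar R} := @lebesgue_measure R.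
pose h := e / (2 * (b - a) + 1).
have ba : 0 < b - a by rewrite subr_gt0.
have h0 : 0 < h by rewrite divr_gt0// ltr_wpDl ?mulr_ge0// ltW.
have eE : e = 2 * h * (b - a) + h.
  by rewrite /h; field; apply: lt0r_neq0; lra.
pose w n : R := n.+2%:R * h.
have w0 n : 0 < w n by rewrite mulr_gt0.
pose A n := `]a, b[ `&` phi @^-1` `[n%:R * h, n.+1%:R * h[.
have mA n : measurable (A n) by apply: mphi.
have muab : mu `]a, b[%classic = (b - a)%:E.
  by apply: etrans (lebesgue_measure_itv _) _; rewrite /= lte_fin ab.
have muA n : (mu (A n) < +oo)%E.
  apply: (@le_lt_trans _ _ (mu `]a, b[%classic)); last by rewrite muab ltry.
  apply: le_measure; [by rewrite inE; exact: mA| |by move=> x []].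
  by rewrite inE; exact: measurable_itv.
have AE : \bigcup_n A n = `]a, b[%classic.
  apply/seteqP; split=> [x [n _ []//]|x xab]; exists (Num.truncn (phi x / h)) => //.
  split=> //=; have p0 : 0 <= phi x by apply: phi0; move: xab; rewrite /= in_itv.
  have := truncn_itv (divr_ge0 p0 (ltW h0)).
  by rewrite ler_pdivlMr// ltr_pdivrMr// in_itv.
have tA : trivIset setT A.
  move=> i j _ _ [x [[xab /=]]]; rewrite in_itv/= => xi [_ /=].
  rewrite in_itv/= => xj.
  have trunc_eq m : m%:R * h <= phi x < m.+1%:R * h -> Num.truncn (phi x / h) = m.
    by rewrite -ler_pdivlMr// -ltr_pdivrMr// => /truncn_def.
  by rewrite -(trunc_eq i xi) (trunc_eq j xj).
pose r n : R := h / (2 ^ n.+1)%:R / w n.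
have r0 n : 0 < r n.
  by apply: divr_gt0; [apply: divr_gt0; rewrite ?ltr0n ?expn_gt0|exact: w0].
have /choice[V VP] n : exists U : set R,
    [/\ open U, A n `<=` U & (mu (U `\` A n) < (r n)%:E)%E].
  exact: lebesgue_regularity_outer.
have oV n : open (V n) by have [] := VP n.
have mV n : measurable (V n) by exact: open_measurable.
pose psi x : \bar R := (\sum_(0 <= n <oo) (w n)%:E * (\1_(V n) x)%:E)%E.
have t0 n x : (0 <= (w n)%:E * (\1_(V n) x)%:E)%E.
  by rewrite mule_ge0// lee_fin ltW.
have mi n (D : set R) : measurable_fun D (fun x : R => (\1_(V n) x)%:E).
  by apply/measurable_EFinP; exact: measurable_indic.
have mt n (D : set R) : measurable_fun D (fun x => (w n)%:E * (\1_(V n) x)%:E)%E.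
  by apply: measurable_funeM; exact: mi.
exists psi, h => //; split.
- by apply: ge0_emeasurable_sum.
- by move=> x; apply: nneseries_ge0.
- move=> x xab; have : (\bigcup_n A n) x by rewrite AE /= in_itv.
  move=> [n _ Anx]; have [_ AV _] := VP n.
  have : nbhs x (V n) by apply: open_nbhs_nbhs; split=> //; exact: AV.
  apply: filterS => y Vny.
  have le1 := @nneseries_lim_ge R _ xpredT 0 n.+1 (fun k _ _ => t0 k y).
  apply: le_trans le1; rewrite big_nat_recr//= indicE mem_set// mule1.
  apply: (@le_trans _ _ (w n)%:E).
    case: Anx => _ /=; rewrite in_itv/= => /andP[_ /ltW phin].
    by rewrite lee_fin /w -[n.+2%:R]natr1 mulrDl mul1r lerD2r.
  by rewrite leeDr// sume_ge0.
rewrite integral_nneseries//; last by move=> n; exact: mt.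
have split_n n : (\int[mu]_(x in `]a, b]) ((w n)%:E * (\1_(V n) x)%:E) <=
    \int[mu]_(x in A n) ((phi x)%:E + (2 * h)%:E) + (h / (2 ^ n.+1)%:R)%:E)%E.
  rewrite ge0_integralZl_EFin//; last 2 first.
  - exact: mi.
  - exact: ltW.
  rewrite integral_indic//; last exact: mV.
  have le1 : (mu (V n `&` `]a, b]%classic) <= mu (A n) + (r n)%:E)%E.
    have [_ AV Ve] := VP n; have mVA := measurableD (mV n) (mA n).
    apply: (@le_trans _ _ (mu (A n `|` V n `\` A n))).
      apply: le_measure; rewrite ?inE.
      - by apply: (measurableI _ _ (mV n)); exact: measurable_itv.
      - exact: measurableU (mA n) mVA.
      - by move=> x [Vx _]; have [?|?] := pselect (A n x); [left|right].
    apply: le_trans (measureU2 _ _ _) _; [exact: mA|exact: mVA|].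
    by rewrite leeD2l// ltW.
  apply: le_trans (lee_wpmul2l _ le1) _; first by rewrite lee_fin ltW.
  rewrite ge0_muleDr ?measure_ge0 ?lee_fin ?(ltW (r0 n))//.
  have -> : ((w n)%:E * (r n)%:E)%E = (h / (2 ^ n.+1)%:R)%:E.
    by rewrite -EFinM /r mulrC divfK ?gt_eqF.
  rewrite leeD2r// -[leLHS](@integral_cst _ _ _ mu (A n))//; last exact: mA.
  apply: ge0_le_integral => //.
  - exact: mA.
  - by move=> x _ /=; rewrite lee_fin ltW.
  - apply: emeasurable_funD => //; apply/measurable_EFinP.
    by apply: measurable_funS mphi => // x [].
  - move=> x [_ /=]; rewrite in_itv/= => /andP[phin _].
    by rewrite -EFinD lee_fin /w -natr1 -natr1 !mulrDl !mul1r; lra.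
apply: (@le_trans _ _ (\sum_(0 <= n <oo)
    (\int[mu]_(x in A n) ((phi x)%:E + (2 * h)%:E) + (h / (2 ^ n.+1)%:R)%:E))%E).
  by apply: lee_nneseries => [n _ _|n _]; [exact: integral_ge0|exact: split_n].
have p2h x : a < x < b -> (0 <= (phi x)%:E + (2 * h)%:E)%E.
  by move=> xab; rewrite -EFinD lee_fin addr_ge0 ?phi0// mulr_ge0// ltW.
apply: le_trans (@epsilon_trick _ _ h xpredT _ _) _.
- move=> n; apply: integral_ge0 => x [xab _]; apply: p2h.
  by move: xab; rewrite /= in_itv.
- exact: ltW.
rewrite -ge0_integral_bigcup//=; first last.
- by rewrite AE => x /=; rewrite in_itv/= => xab; exact: p2h.
- rewrite AE; apply: emeasurable_funD => //; exact/measurable_EFinP.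
have mphiE : measurable_fun `]a, b[ (EFin \o phi) by exact/measurable_EFinP.
have h20 : (0 <= (2 * h)%:E)%E by rewrite lee_fin mulr_ge0// ltW.
have phiE0 x : `]a, b[%classic x -> (0 <= (phi x)%:E)%E.
  by rewrite /= in_itv/= lee_fin; exact: phi0.
rewrite AE ge0_integralD//.
have -> : (\int[mu]_(x in `]a, b[) (2 * h)%:E = (2 * h * (b - a))%:E)%E.
  by rewrite (integral_cst mu (measurable_itv `]a, b[)) [X in (_ * X)%E]muab -EFinM.
by rewrite -addeA -EFinD -eE.
Qed.

(** An everywhere differentiable function need not be the integral of its
    derivative, but its increments are still bounded by the integral of any
    majorant of the derivative; comparing with the primitive of an open majorant
    makes the comparison local. *)
Lemma increment_le_integral (R : realType) (E phi : R -> R) (a b : R) : a < b ->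
  (forall x, a <= x <= b -> E s @[s --> within `[a, b] (nbhs x)] --> E x) ->
  measurable_fun `]a, b[ phi -> (forall x, a < x < b -> 0 <= phi x) ->
  (forall x, a < x < b -> forall e, 0 < e ->
     \forall y \near x^'+, E y - E x <= (phi x + e) * (y - x)) ->
  ((E b - E a)%:E <= \int[lebesgue_measure]_(x in `]a, b[) (phi x)%:E)%E.
Proof.
move=> ab cE mphi phi0 dE.
pose mu : {measure set (measurableTypeR R) -> \bar R} := @lebesgue_measure R.
have [->|Ifin] := eqVneq (\int[mu]_(x in `]a, b[) (phi x)%:E)%E +oo%E.
  by rewrite leey.
apply/lee_addgt0Pr => e e0.
have [psi [h h0 [mpsi psi0 psiphi psie]]] := open_majorant ab e0 mphi phi0.
have I0 : (0 <= \int[mu]_(x in `]a, b[) (phi x)%:E)%E.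
  by apply: integral_ge0 => x /=; rewrite in_itv/= lee_fin; exact: phi0.
pose F x := (\int[mu]_(t in `]a, x]) psi t)%E.
have F0 x : (0 <= F x)%E by apply: integral_ge0.
have FS x y : x <= y -> (F x <= F y)%E.
  move=> xy; apply: ge0_subset_integral => //.
    by apply: measurable_funS mpsi.
  by move=> z /=; rewrite !in_itv/= => /andP[-> /le_trans]; exact.
have Fb : (F b < +oo)%E.
  apply: le_lt_trans psie _.
  by rewrite lte_add_pinfty ?ltry// lt_neqAle Ifin leey.
have Ffin x : x <= b -> F x \is a fin_num.
  by move=> xb; rewrite ge0_fin_numE// (le_lt_trans (FS _ _ xb)).
apply: le_trans psie; rewrite -/(F b) -(fineK (Ffin b _))// lee_fin.
apply: (@le_trans _ _ (fine (F b) - fine (F a))); last first.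
  by rewrite gerBl fine_ge0.
apply: (@le_increment _ E (fun x => fine (F x))) => //.
  move=> x y ax xy yb; apply: fine_le; rewrite ?Ffin ?FS//.
  exact: le_trans xy yb.
move=> x xab; have /andP[ax xb] := xab.
have [r /= r0 rpsi] : nbhs x [set y | ((phi x + h)%:E <= psi y)%E].
  exact: psiphi.
near=> y.
have xy : x < y by near: y; exact: nbhs_right_gt.
have yb : y <= b by near: y; exact: nbhs_right_le.
apply: (@le_trans _ _ ((phi x + h) * (y - x))).
  by near: y; exact: dE.
have FyE : (F y = F x + \int[mu]_(t in `]x, y]) psi t)%E.
  rewrite /F (@itv_bndbnd_setU _ _ _ (BRight x)) ?bnd_simp ?ltW//.
  rewrite ge0_integral_setU//.
    by apply: measurable_funS mpsi.
  apply/disj_setPS => z [] /=; rewrite !in_itv/= => /andP[_ zx] /andP[xz _].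
  by move: zx; rewrite leNgt xz.
have le1 : (((phi x + h) * (y - x))%:E <= \int[mu]_(t in `]x, y]) psi t)%E.
  have -> : ((phi x + h) * (y - x))%:E =
      (\int[mu]_(t in `]x, y]) cst (phi x + h)%:E t)%E.
    rewrite integral_cst//; have -> : mu `]x, y]%classic = (y - x)%:E.
      by apply: etrans (lebesgue_measure_itv _) _; rewrite /= lte_fin xy.
    by rewrite -EFinM.
  apply: ge0_le_integral => //.
  - by move=> t _; rewrite lee_fin addr_ge0 ?phi0// ltW.
  - by apply: measurable_funS mpsi.
  - move=> t /=; rewrite in_itv/= => /andP[xt ty]; apply: rpsi => /=.
    rewrite distrC ger0_norm ?subr_ge0 ?ltW//.
    apply: (@le_lt_trans _ _ (y - x)); first by rewrite lerD2r.
    by near: y; exact: nbhs_right_ltDr.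
rewrite lerBrDl -lee_fin EFinD fineK ?Ffin ?(ltW xb)// fineK ?Ffin// FyE.
by rewrite leeD2l.
Unshelve. all: by end_near. Qed.

(** * Differentiation in time *)

Lemma subrBB (V : zmodType) (x y z w : V) : x - y - (z - w) = x - z - (y - w).
Proof. by rewrite !opprB [w - z]addrC addrACA [- y + w]addrC. Qed.

Section time.
Variables (R : realType) (T : R).
Implicit Types (t s : R).

Lemma near_within_imp (F : set_system R) {FF : Filter F} (P : set R) :
  (forall s, 0 <= s <= T -> P s) -> \forall s \near within `[0, T] F, P s.
Proof.
by move=> TP; rewrite near_withinE; apply: nearW => s /=; rewrite in_itv; exact: TP.
Qed.

Lemma near_within_pos t : 0 < t ->
  \forall s \near within `[0, T] (nbhs t), 0 < s <= T.
Proof.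
move=> t0; rewrite near_withinE; near=> s => /=.
rewrite in_itv/= => /andP[_ sT]; rewrite sT andbT.
by near: s; exact: lt_nbhsr.
Unshelve. all: by end_near. Qed.

Lemma near_right_within t (P : set R) : 0 < t < T ->
  (\forall s \near within `[0, T] t^', P s) -> \forall s \near t^'+, P s.
Proof.
move=> /andP[t0 tT]; rewrite near_withinE near_withinE => Ps.
rewrite near_withinE; near=> s => ts; apply: (near Ps s) => //=.
  by rewrite gt_eqF.
rewrite in_itv/= (ltW (lt_trans t0 ts)) ltW//.
by near: s; exact: lt_nbhsl.
Unshelve. all: by end_near. Qed.

Lemma cvg_right_within (U : topologicalType) (f : R -> U) t (l : U) : 0 < t < T ->
  f s @[s --> within `[0, T] t^'] --> l -> f s @[s --> t^'+] --> l.
Proof. by move=> tT fl P Pl; apply: near_right_within tT _; exact: fl. Qed.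

Lemma cvg_right_nbhs (U : topologicalType) (f : R -> U) t (l : U) : 0 < t < T ->
  f s @[s --> within `[0, T] (nbhs t)] --> l -> f s @[s --> t^'+] --> l.
Proof.
move=> tT fl P Pl; apply: near_right_within tT _.
by rewrite near_withinE; apply: nbhs_dnbhs; exact: fl _ Pl.
Qed.

Lemma near_right_itv t : 0 < t < T -> \forall s \near t^'+, t < s /\ 0 < s <= T.
Proof.
move=> /andP[t0 tT]; near=> s; have ts : t < s by near: s; exact: nbhs_right_gt.
split=> //; rewrite (lt_trans t0 ts)/=; near: s; exact: nbhs_right_le.
Unshelve. all: by end_near. Qed.

(** Only right-hand limits of difference quotients are ever taken: all the points
    of ]0, T[ have them, and their filter is proper. *)
Lemma increment_le_limit (W G : R -> R) t (l phi e : R) :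
  (\forall s \near t^'+, W s - W t <= G s * (s - t)) ->
  G s @[s --> t^'+] --> l -> l <= phi -> 0 < e ->
  \forall y \near t^'+, W y - W t <= (phi + e) * (y - t).
Proof.
move=> WG Gl lphi e0.
have Ge : \forall s \near t^'+, G s <= l + e.
  by apply: (cvgr_le l) => //; rewrite ltrDl.
near=> y; have ty : t < y by near: y; exact: nbhs_right_gt.
have h1 : W y - W t <= G y * (y - t) by near: y.
apply: (le_trans h1); rewrite ler_pM2r ?subr_gt0//.
by apply: (@le_trans _ _ (l + e)); [near: y|rewrite lerD2r].
Unshelve. all: by end_near. Qed.

Lemma cvg_within_nbhs (U : topologicalType) (f : R -> U) (D : set R) t :
  {for t, continuous f} -> f s @[s --> within D (nbhs t)] --> f t.
Proof. by move=> cf; apply: cvg_trans cf; apply: cvg_app; exact: cvg_within. Qed.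

Section derivative.
Variables (V : lmodType R) (S : set V) (b : V -> V -> R).
Hypothesis hb : semi_inner S b.
Implicit Types f ft g gt : R -> V.

(** At the L^2 form of a domain this is convertible to [time_derivative]. *)
Definition si_derivative f ft :=
  [/\ forall t, 0 <= t <= T -> S (f t),
      forall t, 0 <= t <= T ->
        nrm b (f s - f t) @[s --> within `[0, T] (nbhs t)] --> (0 : R) &
      forall t, 0 < t <= T -> S (ft t) /\
        nrm b ((s - t)^-1 *: (f s - f t) - ft t)
          @[s --> within `[0, T] t^'] --> (0 : R)].

Lemma si_derivativeB f ft g gt : si_derivative f ft -> si_derivative g gt ->
  si_derivative (fun t => f t - g t) (fun t => ft t - gt t).
Proof.
move=> [Sf cf df] [Sg cg dg]; split=> t tT.
- exact: (si_memB hb) (Sf _ tT) (Sg _ tT).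
- have -> : (fun s => nrm b (f s - g s - (f t - g t))) =
      (fun s => nrm b ((f s - f t) - (g s - g t))).
    by apply/funext => s; rewrite subrBB.
  apply: (cvg_nrmB hb); [| |exact: cf|exact: cg].
    by apply: near_within_imp => s /Sf Sfs; apply: (si_memB hb) => //; exact: Sf.
  by apply: near_within_imp => s /Sg Sgs; apply: (si_memB hb) => //; exact: Sg.
- have [Sft dft] := df t tT; have [Sgt dgt] := dg t tT.
  have tT' : 0 <= t <= T by case/andP: tT => /ltW -> ->.
  split; first exact: (si_memB hb).
  have -> : (fun s => nrm b ((s - t)^-1 *: (f s - g s - (f t - g t)) - (ft t - gt t))) =
      (fun s => nrm b (((s - t)^-1 *: (f s - f t) - ft t) -
                       ((s - t)^-1 *: (g s - g t) - gt t))).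
    by apply/funext => s; rewrite subrBB scalerBr subrBB.
  apply: (cvg_nrmB hb) => //.
    apply: near_within_imp => s /Sf Sfs.
    by apply: (si_memB hb) => //; apply: (si_memZ hb); apply: (si_memB hb) => //; exact: Sf.
  apply: near_within_imp => s /Sg Sgs.
  by apply: (si_memB hb) => //; apply: (si_memZ hb); apply: (si_memB hb) => //; exact: Sg.
Qed.

Lemma si_derivative_right f ft t : 0 < t < T -> si_derivative f ft ->
  [/\ \forall s \near t^'+, S (f s) /\ S ((s - t)^-1 *: (f s - f t)),
      nrm b (f s - f t) @[s --> t^'+] --> (0 : R) &
      nrm b ((s - t)^-1 *: (f s - f t) - ft t) @[s --> t^'+] --> (0 : R)].
Proof.
move=> tT [Sf cf df]; have /andP[t0 t1] := tT.
have tT' : 0 <= t <= T by rewrite !ltW.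
split.
- apply: near_right_within tT _; apply: near_within_imp => s sT.
  by split; [exact: Sf|apply: (si_memZ hb); apply: (si_memB hb); exact: Sf].
- exact: cvg_right_nbhs tT (cf t tT').
- by apply: cvg_right_within tT _; have [] := df t ltac:(by rewrite t0 ltW).
Qed.

(** The norm of the derivative is a pointwise limit of norms of difference
    quotients, which are continuous in time. *)
Lemma measurable_derivative f ft : si_derivative f ft ->
  measurable_fun `]0, T[ (fun t => nrm b (ft t)).
Proof.
move=> [Sf cf df].
pose sh n s := Num.min (s + n.+1%:R^-1) T.
apply: (@measurable_fun_cvg _ _ _ _
    (fun n s => n.+1%:R * nrm b (f (sh n s) - f s))) => [n|t].
  apply: open_continuous_measurable_fun; first exact: interval_open.
  move=> t; rewrite inE/= in_itv/= => /andP[t0 tT].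
  apply: cvgM; first exact: cvg_cst.
  have shT s : 0 <= s -> 0 <= T -> 0 <= sh n s <= T.
    by move=> s0 T0; rewrite le_min ge_min lexx orbT T0 andbT addr_ge0.
  have T0 : 0 <= T by exact: le_trans (ltW t0) (ltW tT).
  have sh_cvg : sh n s @[s --> t] --> within `[0, T] (nbhs (sh n t)).
    move=> P PT; have : sh n s @[s --> t] --> sh n t.
      apply: (@continuous_min _ _ (fun s => s + n.+1%:R^-1) (cst T)).
        by apply: cvgD; [exact: cvg_id|exact: cvg_cst].
      exact: cvg_cst.
    move=> /(_ _ PT); apply: filterS2 (lt_le_nbhsr t0) => s s0; apply.
    exact: shT s s0 T0.
  have tT' : 0 <= t <= T by rewrite !ltW.
  have near0T : \forall s \near t, 0 <= s <= T.
    by near=> s; apply/andP; split; apply: ltW; near: s;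
      [exact: lt_nbhsr|exact: lt_nbhsl].
  have id_cvg : s @[s --> t] --> within `[0, T] (nbhs t).
    by move=> P Pt; apply: filterS2 near0T Pt => s sT; apply; exact: sT.
  have Sshift s : 0 <= s <= T -> S (f (sh n s) - f s).
    by move=> sT; apply: (si_memB hb); [apply/Sf/shT => //; case/andP: sT|exact: Sf].
  apply: (cvg_nrm hb); first exact: Sshift.
    by apply: filterS near0T.
  have -> : (fun s => nrm b (f (sh n s) - f s - (f (sh n t) - f t))) =
      (fun s => nrm b ((f (sh n s) - f (sh n t)) - (f s - f t))).
    by apply/funext => s; rewrite subrBB.
  apply: (cvg_nrmB hb).
  - apply: filterS near0T => s sT.
    by apply: (si_memB hb); apply/Sf/shT => //; case/andP: sT => // _ _; exact: ltW.
  - by apply: filterS near0T => s sT; apply: (si_memB hb); exact: Sf.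
  - apply: (cvg_comp _ _ sh_cvg (cf (sh n t) _)).
    by apply: shT => //; exact: ltW.
  - exact: (cvg_comp _ _ id_cvg (cf t _)).
rewrite /= in_itv/= => /andP[t0 tT].
have [Sft dft] := df t ltac:(by rewrite t0 ltW).
have tT' : 0 <= t <= T by rewrite !ltW.
have nT : \forall n \near \oo, t + n.+1%:R^-1 < T.
  have := near_infty_natSinv_lt (PosNum (etrans (subr_gt0 _ _) tT)).
  by apply: filterS => n /=; rewrite ltrBrDl.
have u_cvg : (t + n.+1%:R^-1) @[n --> \oo] --> within `[0, T] t^'.
  move=> P Pt.
  have : t + n.+1%:R^-1 @[n --> \oo] --> t.
    rewrite -[X in _ --> X]addr0; apply: cvgD; first exact: cvg_cst.
    exact: cvg_harmonic.
  move=> /(_ _ Pt); apply: filterS2 nT => n nT; apply.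
    by rewrite /= -subr_eq0 addrAC subrr add0r gt_eqF// invr_gt0.
  by rewrite /= in_itv/=; apply/andP; split; rewrite ?addr_ge0 ?ltW.
have := cvg_comp _ _ u_cvg dft.
set v := (fun n : nat => (n.+1%:R : R) *: (f (t + n.+1%:R^-1) - f t)).
have -> : (fun s => nrm b ((s - t)^-1 *: (f s - f t) - ft t)) \o
    (fun n : nat => t + n.+1%:R^-1) = (fun n => nrm b (v n - ft t)).
  apply/funext => n; rewrite /= /v.
  by rewrite [t + _ - t]addrAC subrr add0r invrK.
have Sv : \forall n \near \oo, S (v n).
  apply: filterS nT => n nT; apply: (si_memZ hb); apply: (si_memB hb); last exact: Sf.
  by apply: Sf; rewrite addr_ge0 ?ltW.
move=> /(cvg_nrm hb Sft Sv); apply: cvg_trans; apply: near_eq_cvg.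
apply: filterS nT => n nT.
have Sd : S (f (t + n.+1%:R^-1) - f t).
  by apply: (si_memB hb); apply: Sf => //; rewrite addr_ge0 ?ltW.
by rewrite /v (nrmZ hb)// ger0_norm// /sh min_l ?ltW.
Unshelve. all: by end_near. Qed.

End derivative.
End time.

(** * The energy estimates *)

Section energy.
Variables (R : realType) (H X Y : lmodType R).
Variables (S : set H) (b : H -> H -> R) (a : X -> X -> R) (c : Y -> Y -> R).
Hypothesis hb : semi_inner S b.
Hypothesis ha : semi_inner setT a.
Hypothesis hc : semi_inner setT c.
Variables T mu lambda kappa Ku Kp : R.
Hypotheses (mu0 : 0 < mu) (lambda0 : 0 < lambda) (kappa0 : 0 < kappa).
Variables (xu : R -> X) (xp : R -> Y) (xq xq' hp hp' r r' : R -> H).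
Hypothesis dq : si_derivative T S b xq xq'.
Hypothesis dp : si_derivative T S b hp hp'.
Hypothesis dr : si_derivative T S b r r'.
Hypothesis eq_u : forall s t, 0 < s <= T -> 0 < t <= T ->
  2 * mu * lambda * a (xu s) (xu t) = - b (r t) (xq s).
Hypothesis eq_p : forall s t, 0 < s <= T -> 0 < t <= T ->
  kappa * c (xp s) (xp t) = lambda^-1 * b (r' s) (hp t).
Hypothesis u_le : forall s, 0 <= s <= T ->
  a (xu s) (xu s) <= Ku * b (xq s) (xq s).
Hypothesis p_le : forall s t, 0 <= s <= T -> 0 <= t <= T ->
  c (xp s - xp t) (xp s - xp t) <= Kp * b (hp s - hp t) (hp s - hp t).
Hypotheses (xq0 : b (xq 0) (xq 0) = 0) (hp0 : b (hp 0) (hp 0) = 0)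
  (xp0 : c (xp 0) (xp 0) = 0).

(** In the application [xu], [xq], [xp] are the differences between the projections
    and the scheme, [hp] is [xp] seen as a square integrable function, and [r] is
    the difference of the full errors of [q] and [p]; then [r' - (xq' - hp')] is
    the datum [eta'], and [eq_u], [eq_p] are the equations of the scheme tested
    with the differences themselves. *)
Let y t := xq t - hp t.
Let y' t := xq' t - hp' t.
Let N t := nrm b (r' t - y' t).
Let E t := mu * a (xu t) (xu t) + (2 * lambda)^-1 * b (y t) (y t).
Let F t := kappa * c (xp t) (xp t).

Let dy : si_derivative T S b y y' := si_derivativeB hb dq dp.

Let pos_nng t : 0 < t <= T -> 0 <= t <= T.
Proof. by case/andP => /ltW -> ->. Qed.

Let Sq t : 0 <= t <= T -> S (xq t). Proof. by case: dq => + _ _; apply. Qed.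
Let Sr t : 0 <= t <= T -> S (r t). Proof. by case: dr => + _ _; apply. Qed.
Let Sp t : 0 <= t <= T -> S (hp t). Proof. by case: dp => + _ _; apply. Qed.
Let Sy t : 0 <= t <= T -> S (y t). Proof. by case: dy => + _ _; apply. Qed.
Let Sq' t : 0 < t <= T -> S (xq' t). Proof. by case: dq => _ _ d /d[]. Qed.
Let Sr' t : 0 < t <= T -> S (r' t). Proof. by case: dr => _ _ d /d[]. Qed.
Let Sp' t : 0 < t <= T -> S (hp' t). Proof. by case: dp => _ _ d /d[]. Qed.
Let Sy' t : 0 < t <= T -> S (y' t). Proof. by case: dy => _ _ d /d[]. Qed.

Let a_xu s t : 0 < s <= T -> 0 < t <= T ->
  mu * a (xu s) (xu t) = - (2 * lambda)^-1 * b (r t) (xq s).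
Proof.
move=> sT tT; rewrite mulNr -mulrN -(eq_u sT tT); field.
exact: lt0r_neq0.
Qed.

(** [a (xu s) (xu t)] being symmetric, so is [b (r t) (xq s)]; hence the
    increments of the two summands of [E] are increments of [r] and [y] tested
    against sums, and [xu] itself is never differentiated. *)
Let E_increment s t : 0 < s <= T -> 0 < t <= T ->
  E s - E t = - (2 * lambda)^-1 * b (r s - r t) (xq s + xq t) +
              (2 * lambda)^-1 * b (y s - y t) (y s + y t).
Proof.
move=> sT tT; have [sT' tT'] := (pos_nng sT, pos_nng tT).
have key : b (r t) (xq s) = b (r s) (xq t).
  by apply: oppr_inj; rewrite -(eq_u sT tT) -(eq_u tT sT) (si_sym ha).
have [[rs rt] [qs qt] [ys yt]] :=
  And3 (conj (Sr sT') (Sr tT')) (conj (Sq sT') (Sq tT')) (conj (Sy sT') (Sy tT')).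
rewrite /E !a_xu// (siBl hb rs rt (si_memD hb qs qt)) (siBl hb ys yt (si_memD hb ys yt)).
rewrite (siDr hb qs qt rs) (siDr hb qs qt rt) (siDr hb ys yt ys) (siDr hb ys yt yt).
by rewrite key (si_sym hb (y s) (y t)); ring.
Qed.

Let itv_oo t : 0 < t < T -> 0 < t <= T.
Proof. by case/andP => -> /ltW. Qed.

(** The difference quotients satisfy [b dr dxq = - 2 mu lambda a dxu dxu]. *)
Let r'_xq'_le0 t : 0 < t < T -> b (r' t) (xq' t) <= 0.
Proof.
move=> tT; have tT1 := itv_oo tT; have tT' := pos_nng tT1.
have [Sdr _ r'E] := si_derivative_right hb tT dr.
have [Sdq _ q'E] := si_derivative_right hb tT dq.
have lim : b ((s - t)^-1 *: (r s - r t)) ((s - t)^-1 *: (xq s - xq t))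
    @[s --> t^'+] --> b (r' t) (xq' t).
  exact: (cvg_si hb (Sr' tT1) (Sq' tT1)
  (filterS (fun s => @proj2 _ _) Sdr) (filterS (fun s => @proj2 _ _) Sdq) r'E q'E).
have k0 : 0 <= 2 * mu * lambda by rewrite !mulr_ge0// ltW.
suff : \forall s \near t^'+,
    b ((s - t)^-1 *: (r s - r t)) ((s - t)^-1 *: (xq s - xq t)) <= 0.
  by move=> le0; exact: cvgr_to_le lim le0.
apply: filterS (near_right_itv tT) => s [ts sT].
have sT' := pos_nng sT.
have [[rs rt] [qs qt]] := conj (conj (Sr sT') (Sr tT')) (conj (Sq sT') (Sq tT')).
have [drS dqS] := conj (si_memB hb rs rt) (si_memB hb qs qt).
rewrite (siZl hb _ drS (si_memZ hb _ dqS)) (siZr hb _ dqS drS).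
rewrite mulrA -expr2 pmulr_rle0 ?exprn_gt0 ?invr_gt0 ?subr_gt0//.
have := mulr_ge0 k0 (si_ge0 ha (xu s - xu t)).
rewrite (siBB ha)// (siBl hb rs rt dqS) (siBr hb qs qt rs) (siBr hb qs qt rt).
have := eq_u sT sT; have := eq_u tT1 tT1; have := eq_u sT tT1; have := eq_u tT1 sT.
rewrite (si_sym ha (xu t) (xu s)); lra.
Qed.

Let i2l_ge0 : 0 <= (2 * lambda)^-1.
Proof. by rewrite invr_ge0 mulr_ge0// ltW. Qed.

Let N_sqr t : N t ^+ 2 = b (r' t - y' t) (r' t - y' t).
Proof. exact: (nrm_sqr hb). Qed.

Let E_ge0 t : 0 <= E t.
Proof.
apply: addr_ge0; first by rewrite mulr_ge0 ?(si_ge0 ha)// ltW.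
by rewrite mulr_ge0 ?(si_ge0 hb).
Qed.

(** Testing the equation of [xp] with itself turns the limit of the difference
    quotients of [E] into [- kappa c xp xp - b eta' y / lambda]. *)
Let E_growth t e : 0 < t < T -> 0 < e ->
  \forall s \near t^'+,
    E s - E t <= (E t + (2 * lambda)^-1 * N t ^+ 2 + e) * (s - t).
Proof.
move=> tT e0; have tT1 := itv_oo tT; have tT' := pos_nng tT1.
have [Sdr _ r'E] := si_derivative_right hb tT dr.
have [Sdq qc _] := si_derivative_right hb tT dq.
have [Sdy yc y'E] := si_derivative_right hb tT dy.
have l0 : lambda != 0 by exact: lt0r_neq0.
have Ss (f : R -> H) : (forall s, 0 <= s <= T -> S (f s)) ->
    \forall s \near t^'+, S (f s + f t).
  move=> Sf; apply: filterS (near_right_itv tT) => s [_ /pos_nng sT].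
  by apply: (si_memD hb); exact: Sf.
have sum_cvg (f : R -> H) :
    nrm b (f s - f t) @[s --> t^'+] --> (0 : R) ->
    nrm b (f s + f t - (f t + f t)) @[s --> t^'+] --> (0 : R).
  have -> // : (fun s => nrm b (f s + f t - (f t + f t))) =
      (fun s => nrm b (f s - f t)).
    by apply/funext => s; rewrite opprD addrACA subrr addr0.
have l1 : b ((s - t)^-1 *: (r s - r t)) (xq s + xq t) @[s --> t^'+] -->
    b (r' t) (xq t + xq t).
  exact: (cvg_si hb (Sr' tT1) (si_memD hb (Sq tT') (Sq tT'))
  (filterS (fun s => @proj2 _ _) Sdr) (Ss _ Sq) r'E (sum_cvg _ qc)).
have l2 : b ((s - t)^-1 *: (y s - y t)) (y s + y t) @[s --> t^'+] -->
    b (y' t) (y t + y t).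
  exact: (cvg_si hb (Sy' tT1) (si_memD hb (Sy tT') (Sy tT'))
  (filterS (fun s => @proj2 _ _) Sdy) (Ss _ Sy) y'E (sum_cvg _ yc)).
apply: (@increment_le_limit _ _ (fun s =>
    - (2 * lambda)^-1 * b ((s - t)^-1 *: (r s - r t)) (xq s + xq t) +
    (2 * lambda)^-1 * b ((s - t)^-1 *: (y s - y t)) (y s + y t)) _
    (- (2 * lambda)^-1 * b (r' t) (xq t + xq t) +
    (2 * lambda)^-1 * b (y' t) (y t + y t))) => //.
- apply: filterS (near_right_itv tT) => s [ts sT]; have sT' := pos_nng sT.
  have [[rs rt] [qs qt] [ys yt]] :=
    And3 (conj (Sr sT') (Sr tT')) (conj (Sq sT') (Sq tT')) (conj (Sy sT') (Sy tT')).
  rewrite E_increment//=.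
  rewrite (siZl hb _ (si_memB hb rs rt) (si_memD hb qs qt)).
  rewrite (siZl hb _ (si_memB hb ys yt) (si_memD hb ys yt)).
  rewrite le_eqVlt; apply/orP; left; apply/eqP.
  by field; rewrite l0 subr_eq0 gt_eqF.
- by apply: cvgD; apply: cvgM => //; exact: cvg_cst.
have [[Hr' Hy'] [Hq Hp Hy]] :=
  conj (conj (Sr' tT1) (Sy' tT1)) (And3 (Sq tT') (Sp tT') (Sy tT')).
rewrite (siDr hb Hq Hq Hr') (siDr hb Hy Hy Hy').
have eqp := eq_p tT1 tT1.
have cp : 0 <= kappa * c (xp t) (xp t) by rewrite mulr_ge0 ?(si_ge0 hc)// ltW.
have by' : b (y' t) (y t) = b (r' t) (xq t) - b (r' t) (hp t) - b (r' t - y' t) (y t).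
  by rewrite (siBl hb Hr' Hy' Hy) [b (r' t) (y t)](siBr hb Hq Hp Hr'); ring.
have am : - (2 * b (r' t - y' t) (y t)) <= N t ^+ 2 + b (y t) (y t).
  rewrite N_sqr; have := si_ge0 hb (r' t - y' t + y t).
  by rewrite (siDD hb (si_memB hb Hr' Hy') Hy); lra.
have li : (2 * lambda)^-1 = lambda^-1 / 2 by field.
have li0 : 0 < lambda^-1 by rewrite invr_gt0.
have aa : 0 <= mu * a (xu t) (xu t) by rewrite mulr_ge0 ?(si_ge0 ha)// ltW.
rewrite {}by' /E li.
have := ler_wpM2l (ltW li0) am.
rewrite eqp in cp; lra.
Qed.

(** The limit of the difference quotients of [F] is [2 b r' hp' / lambda]. Since
    [b r' xq' <= 0], it is at most [- 2 b r' y' / lambda], and completing the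
    square in [r' = eta' + y'] leaves [N ^+ 2 / (2 lambda)]. The term in [Kp] comes
    from [c (xp s - xp t) (xp s - xp t)] and is of second order in [s - t]. *)
Let F_growth t e : 0 < t < T -> 0 < e ->
  \forall s \near t^'+, F s - F t <= ((2 * lambda)^-1 * N t ^+ 2 + e) * (s - t).
Proof.
move=> tT e0; have tT1 := itv_oo tT; have tT' := pos_nng tT1.
have [Sdp _ p'E] := si_derivative_right hb tT dp.
have l0 : lambda != 0 by exact: lt0r_neq0.
have Sd : \forall s \near t^'+, S ((s - t)^-1 *: (hp s - hp t)).
  by apply: filterS Sdp => s [].
have r0 : nrm b (r' t - r' t) @[s --> t^'+] --> (0 : R).
  rewrite subrr (_ : nrm b 0 = 0); first exact: cvg_cst.
  have Hr := Sr' tT1; rewrite /nrm -(subrr (r' t)) (siBl hb Hr Hr (si_memB hb Hr Hr)).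
  by rewrite subrr sqrtr0.
have l1 : b (r' t) ((s - t)^-1 *: (hp s - hp t)) @[s --> t^'+] --> b (r' t) (hp' t).
  have Sc : \forall s \near t^'+, S ((fun=> r' t) s) by apply: nearW => s; exact: Sr'.
  exact: (cvg_si hb (Sr' tT1) (Sp' tT1) Sc Sd r0 p'E).
have l2 : b ((s - t)^-1 *: (hp s - hp t)) ((s - t)^-1 *: (hp s - hp t))
    @[s --> t^'+] --> b (hp' t) (hp' t).
  exact: (cvg_si hb (Sp' tT1) (Sp' tT1) Sd Sd p'E p'E).
have st : s - t @[s --> t^'+] --> (0 : R).
  rewrite -(subrr t); apply: cvgB; last exact: cvg_cst.
  by apply: cvg_at_right_filter; exact: cvg_id.
apply: (@increment_le_limit _ _ (fun s =>
    2 * lambda^-1 * b (r' t) ((s - t)^-1 *: (hp s - hp t)) + kappa * Kp * ((s - t) *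
      b ((s - t)^-1 *: (hp s - hp t)) ((s - t)^-1 *: (hp s - hp t)))) _
    (2 * lambda^-1 * b (r' t) (hp' t) + kappa * Kp * (0 * b (hp' t) (hp' t)))) => //.
- apply: filterS (near_right_itv tT) => s [ts sT]; have sT' := pos_nng sT.
  have [Hr [ps pt]] := conj (Sr' tT1) (conj (Sp sT') (Sp tT')).
  have dpS := si_memB hb ps pt; have dqS := si_memZ hb (s - t)^-1 dpS.
  rewrite (siZr hb _ dpS Hr) (siZl hb _ dpS dqS) (siZr hb _ dpS dpS).
  have := ler_wpM2l (ltW kappa0) (p_le sT' tT').
  rewrite (siBB hc)// (si_sym hc (xp s)) (siBr hb ps pt Hr).
  have e1 := eq_p tT1 sT; have e2 := eq_p tT1 tT1.
  have st0 : s - t != 0 by rewrite subr_eq0 gt_eqF.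
  rewrite [X in _ -> _ <= X](_ : _ = 2 * (lambda^-1 * b (r' t) (hp s)) -
    2 * (lambda^-1 * b (r' t) (hp t)) +
    kappa * (Kp * b (hp s - hp t) (hp s - hp t))); last by field; rewrite l0.
  rewrite -e1 -e2 /F; lra.
- apply: cvgD; apply: cvgM => //; try exact: cvg_cst.
  exact: cvgM.
have [Hr' [Hy' [Hq' Hp']]] := conj (Sr' tT1) (conj (Sy' tT1) (conj (Sq' tT1) (Sp' tT1))).
have le0 := r'_xq'_le0 tT.
have E1 : b (r' t) (hp' t) = b (r' t) (xq' t) - b (r' t) (y' t).
  by rewrite [b (r' t) (y' t)](siBr hb Hq' Hp' Hr'); ring.
have am : - (4 * b (r' t) (y' t)) <= N t ^+ 2.
  rewrite N_sqr; have := si_ge0 hb (r' t - y' t + 2 *: y' t).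
  have S2 := si_memZ hb 2 Hy'; have Sd' := si_memB hb Hr' Hy'.
  rewrite (siDD hb Sd' S2) (siZr hb _ Hy' Sd') (siZl hb _ Hy' S2).
  rewrite (siZr hb _ Hy' Hy') (siBl hb Hr' Hy' Hy'); lra.
have li : (2 * lambda)^-1 = lambda^-1 / 2 by field.
have li0 : 0 < lambda^-1 by rewrite invr_gt0.
rewrite mul0r mulr0 addr0 E1 li.
have := ler_wpM2l (ltW li0) am; have := ler_wpM2l (ltW li0) le0; lra.
Qed.

Let cvg_b (f g : R -> H) ft gt t :
  si_derivative T S b f ft -> si_derivative T S b g gt -> 0 <= t <= T ->
  b (f s) (g s) @[s --> within `[0, T] (nbhs t)] --> b (f t) (g t).
Proof.
move=> [Sf cf _] [Sg cg _] tT.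
apply: (cvg_si hb (Sf _ tT) (Sg _ tT) _ _ (cf _ tT) (cg _ tT)).
  exact: near_within_imp.
exact: near_within_imp.
Qed.

(** At positive times [eq_u] expresses the strain through [r] and [xq]; at time 0,
    where the equations are not imposed, [u_le] forces it to vanish in the limit. *)
Let E_cvg t : 0 <= t <= T -> E s @[s --> within `[0, T] (nbhs t)] --> E t.
Proof.
move=> tT; have /andP[t0 tT1] := tT.
have yc := cvg_b dy dy tT.
apply: cvgD; last by apply: cvgM => //; exact: cvg_cst.
have := t0; rewrite le_eqVlt => /predU1P[t0E|{}t0].
  rewrite -t0E in tT *.
  have ub : Ku * b (xq s) (xq s) @[s --> within `[0, T] (nbhs 0)] --> (0 : R).
    have b0 := cvg_b dq dq tT; rewrite xq0 in b0.
    by rewrite -[X in _ --> X](mulr0 Ku); apply: cvgM => //; exact: cvg_cst.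
  have a0 : a (xu 0) (xu 0) = 0.
    apply/eqP; rewrite eq_le (si_ge0 ha) andbT.
    by have := u_le tT; rewrite xq0 mulr0.
  apply: cvgM; first exact: cvg_cst.
  rewrite a0; apply: squeeze_cvgr (cvg_cst 0) ub.
  by apply: near_within_imp => s sT; rewrite (si_ge0 ha)/=; exact: u_le.
have tT' : 0 < t <= T by rewrite t0.
rewrite a_xu//.
have : - (2 * lambda)^-1 * b (r s) (xq s) @[s --> within `[0, T] (nbhs t)] -->
    - (2 * lambda)^-1 * b (r t) (xq t).
  by apply: cvgM; [exact: cvg_cst|exact: cvg_b dr dq tT].
apply: cvg_trans; apply: near_eq_cvg.
by apply: filterS (near_within_pos T t0) => s sT; rewrite a_xu.
Qed.

Let F_cvg t : 0 <= t <= T -> F s @[s --> within `[0, T] (nbhs t)] --> F t.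
Proof.
move=> tT; apply: cvgM; first exact: cvg_cst.
suff dc : nrm c (xp s - xp t) @[s --> within `[0, T] (nbhs t)] --> (0 : R).
  have nT : \forall s \near within `[0, T] (nbhs t), [set: Y] (xp s) by exact: nearW.
  exact: (cvg_si hc I I nT nT dc dc).
have [_ /(_ t tT) pc _] := dp.
have ub : Num.sqrt Kp * nrm b (hp s - hp t)
    @[s --> within `[0, T] (nbhs t)] --> (0 : R).
  by rewrite -[X in _ --> X](mulr0 (Num.sqrt Kp)); apply: cvgM => //; exact: cvg_cst.
apply: squeeze_cvgr (cvg_cst 0) ub; apply: near_within_imp => s sT.
rewrite nrm_ge0/= /nrm.
have [Kp0|Kp0] := leP 0 Kp.
  by rewrite -sqrtrM//; apply: ler_wsqrtr; exact: p_le.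
rewrite [X in X <= _]ler0_sqrtr ?mulr_ge0 ?sqrtr_ge0//.
apply: le_trans (p_le sT tT) _.
by rewrite mulr_le0_ge0 ?(si_ge0 hb)// ltW.
Qed.

Let J (t : R) := (\int[lebesgue_measure]_(s in `[0%R, t]) (N s ^+ 2)%:E)%E.

Let growth_integral (W : R -> R) t : 0 < t <= T ->
  (forall s, 0 <= s <= T -> W x @[x --> within `[0, T] (nbhs s)] --> W s) ->
  (forall s e, 0 < s < T -> 0 < e -> \forall x \near s^'+,
     W x - W s <= ((2 * lambda)^-1 * N s ^+ 2 + e) * (x - s)) ->
  ((W t - W 0)%:E <= ((2 * lambda)^-1)%:E * J t)%E.
Proof.
move=> /andP[t0 tT] cW dW.
have mN : measurable_fun `]0, t[ (fun s => N s ^+ 2).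
  apply: measurable_funX.
  apply: measurable_funS (measurable_derivative hb (si_derivativeB hb dr dy)) => //.
  by move=> s /=; rewrite !in_itv/= => /andP[-> /lt_le_trans ->].
have mphi : measurable_fun `]0, t[ (fun s => (2 * lambda)^-1 * N s ^+ 2).
  by apply: measurable_funM => //; exact: measurable_cst.
have -> : J t = (\int[lebesgue_measure]_(s in `]0%R, t[) (N s ^+ 2)%:E)%E.
  have mN' : measurable_fun `]0, t[ (fun s => (N s ^+ 2)%:E) by exact/measurable_EFinP.
  rewrite (integral_itv_bndo_bndc mN') integral_itv_obnd_cbnd//.
  by apply/measurable_EFinP/measurable_fun_itv_bndo_bndcP.
rewrite -ge0_integralZl_EFin//; last 2 first.
- by move=> s _; rewrite lee_fin sqr_ge0.
- exact/measurable_EFinP.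
apply: (increment_le_integral t0 _ mphi) => [s /andP[s0 st]|s st|s /andP[s0 st] e e0].
- apply: cvg_trans (cW s _); last by rewrite s0 (le_trans st).
  apply: cvg_app => P PT.
  have {}PT : \forall x \near s, `[0, T]%classic x -> P x := PT.
  suff : \forall x \near s, `[0, t]%classic x -> P x by [].
  apply: filterS PT => x Px xt; apply: Px; move: xt; rewrite /= !in_itv/=.
  by move=> /andP[-> /le_trans ->].
- by rewrite mulr_ge0 ?sqr_ge0.
- by apply: dW => //; rewrite s0 (lt_le_trans st).
Qed.

Lemma energy_estimate_p t : 0 < t <= T ->
  ((kappa * c (xp t) (xp t))%:E <= ((2 * lambda)^-1)%:E *
   \int[lebesgue_measure]_(s in `[0%R, t])
     (nrm b (r' s - (xq' s - hp' s)) ^+ 2)%:E)%E.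
Proof.
move=> tT; have := growth_integral tT F_cvg (fun s e sT e0 => F_growth sT e0).
by rewrite /F xp0 mulr0 subr0.
Qed.

(** Gronwall's inequality, through the integrating factor [expR (- t)]. *)
Lemma energy_estimate_u t : 0 < t <= T ->
  ((mu * a (xu t) (xu t))%:E <= (expR T * (2 * lambda)^-1)%:E *
   \int[lebesgue_measure]_(s in `[0%R, t])
     (nrm b (r' s - (xq' s - hp' s)) ^+ 2)%:E)%E.
Proof.
move=> tT; have /andP[t0 tT1] := tT.
pose W s := expR (- s) * E s.
have W0 : W 0 = 0.
  have T00 : 0 <= (0 : R) <= T by rewrite lexx/= (le_trans (ltW t0)).
  have a0 : a (xu 0) (xu 0) = 0.
    apply/eqP; rewrite eq_le (si_ge0 ha) andbT.
    by have := u_le T00; rewrite xq0 mulr0.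
  rewrite /W /E a0 (siBB hb (Sq T00) (Sp T00)) xq0 hp0.
  by rewrite (si_null_l hb (Sq T00) (Sp T00) xq0); ring.
have WJ : ((W t - W 0)%:E <= ((2 * lambda)^-1)%:E * J t)%E.
  apply: growth_integral => // [s sT|s e sT e0].
    apply: cvgM; last exact: E_cvg.
    apply: (@cvg_within_nbhs _ _ (fun s => expR (- s))).
    by apply: continuous_comp; [exact: opp_continuous|exact: continuous_expR].
  apply: filterS2 (E_growth sT e0) (near_right_itv sT) => x Ex [sx /andP[x0 _]].
  have ex1 : expR (- x) <= 1 by rewrite -expR0 ler_expR oppr_le0 ltW.
  have ex0 := expR_ge0 (- x).
  (* From 1 + h <= expR h: the decrease of the factor compensates the term E s. *)
  have exs : expR (- x) * (1 + (x - s)) <= expR (- s).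
    rewrite [X in _ <= expR X](_ : - s = - x + (x - s)); last by ring.
    by rewrite expRD; apply: ler_wpM2l => //; exact: expR_ge1Dx.
  have phi0 : 0 <= (2 * lambda)^-1 * N s ^+ 2.
    by rewrite mulr_ge0 ?sqr_ge0.
  have h1 := ler_wpM2l ex0 Ex.
  have h2 := ler_wpM2l (E_ge0 s) exs.
  have h3 : 0 <= (1 - expR (- x)) * (((2 * lambda)^-1 * N s ^+ 2 + e) * (x - s)).
    rewrite mulr_ge0 ?subr_ge0// mulr_ge0 ?subr_ge0 ?(ltW sx)//.
    by rewrite addr_ge0// ltW.
  rewrite /W; lra.
rewrite W0 subr0 in WJ.
have aE : mu * a (xu t) (xu t) <= expR t * W t.
  by rewrite /W mulrA -expRD subrr expR0 mul1r lerDl mulr_ge0 ?(si_ge0 hb).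
apply: (@le_trans _ _ ((expR T)%:E * (W t)%:E)%E).
  rewrite -EFinM lee_fin (le_trans aE)// ler_wpM2r ?ler_expR//.
  by rewrite mulr_ge0 ?expR_ge0.
rewrite [(expR T * _)%:E]EFinM -[X in (_ <= X)%E]muleA; exact: lee_wpmul2l.
Qed.

End energy.

(** * Inverse inequalities on finite-dimensional spaces *)

Section inverse_inequality.
Variables (R : realType) (V : lmodType R) (b c : V -> V -> R).
Hypothesis hb : semi_inner setT b.
Hypothesis hc : semi_inner setT c.

Definition orthonormal n (w : 'I_n -> V) := forall i j, b (w i) (w j) = (i == j)%:R.

Lemma si_suml n (u : 'I_n -> R) (w : 'I_n -> V) z :
  b (\sum_i u i *: w i) z = \sum_i u i * b (w i) z.
Proof.
apply: (big_rec2 (fun x y => b x z = y)) => [|i x y _ <-].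
  by rewrite -(scale0r z) (siZl hb)// mul0r.
by rewrite (si_linear hb).
Qed.

(** One unit vector is split off at a time; once none is left the space is in the
    kernel of [b], hence in that of [c]. Orthonormal families measure the
    dimension modulo the kernel of [b], where functions equal almost everywhere
    are identified. *)
Lemma inverse_inequality n (W : set V) :
  (forall k x y, W x -> W y -> W (k *: x + y)) ->
  (forall w, W w -> b w w = 0 -> c w w = 0) ->
  (forall w : 'I_n.+1 -> V, (forall i, W (w i)) -> ~ orthonormal w) ->
  exists2 K, 0 <= K & forall w, W w -> c w w <= K * b w w.
Proof.
have unit (W' : set V) e : (forall k x y, W' x -> W' y -> W' (k *: x + y)) ->
    W' e -> b e e != 0 -> exists2 e', W' e' & b e' e' = 1.
  move=> WW We e0; exists ((Num.sqrt (b e e))^-1 *: e).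
    by rewrite -[X in X *: e](subrK 1) scalerDl scale1r; exact: WW.
  rewrite (siZl hb)// (siZr hb)// mulrA -expr2 exprVn sqr_sqrtr ?(si_ge0 hb)//.
  exact: mulVf.
elim: n W => [|n IH] W WW W0 Wn.
  exists 0 => // w Ww; rewrite mul0r W0//; apply/eqP/negP => /negP w0.
  have [e We e1] := unit W w WW Ww w0.
  apply: (Wn (fun=> e)) => // i j; by rewrite !ord1 eqxx.
have [[w [Ww w0]]|Wnull] := pselect (exists w, W w /\ b w w != 0); last first.
  exists 0 => // w Ww; rewrite mul0r W0//; apply/eqP/negP => /negP w0.
  by apply: Wnull; exists w.
have [e We e1] := unit W w WW Ww w0.
have [|v [Wv _] v0|v Wv ov|K K0 WK] := IH [set w | W w /\ b w e = 0].
- move=> k x y [Wx xe] [Wy ye]; split; first exact: WW.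
  by rewrite (si_linear hb)// xe ye mulr0 addr0.
- exact: W0.
- apply: (Wn (fun i => if unlift ord0 i is Some j then v j else e)) => [i|i j].
    by case: unliftP => // j _; have [] := Wv j.
  case: unliftP => [i' ->|->]; case: unliftP => [j' ->|->].
  + by rewrite ov (inj_eq (@lift_inj _ _)).
  + by have [_ ->] := Wv i'.
  + by rewrite (si_sym hb); have [_ ->] := Wv j'.
  + by rewrite e1 eqxx.
exists (2 * c e e + 2 * K).
  by rewrite addr_ge0// mulr_ge0// (si_ge0 hc).
move=> x Wx; pose x' := - b x e *: e + x.
have x'e : b x' e = 0 by rewrite (si_linear hb)// e1 mulr1 addNr.
have Wx' : W x' by exact: WW.
have xE : x = b x e *: e + x' by rewrite /x' addrA -scalerDl subrr scale0r add0r.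
have bx : b x x = b x e ^+ 2 + b x' x'.
  rewrite {1 2}xE (siDD hb)// (siZl hb)// (siZr hb)// e1 (siZl hb)// (si_sym hb e) x'e.
  by ring.
have := WK x' (conj Wx' x'e).
have := siDD_le hc (x := b x e *: e) (y := x') I I; rewrite -xE.
rewrite (siZl hc)// (siZr hc)// bx => h1 h2.
apply: (le_trans h1).
have p1 := mulr_ge0 (si_ge0 hc e) (si_ge0 hb x'); have p2 := mulr_ge0 K0 (sqr_ge0 (b x e)).
rewrite !expr2 in p2 *; lra.
Qed.

(** More than [n] vectors with coordinates in [R^n] are linearly dependent modulo
    the kernel of [b]. The coordinates are only related to the vectors, since
    they need not be unique. *)
Lemma no_orthonormal n (rel : V -> 'rV[R]_n -> Prop) (w : 'I_n.+1 -> V) :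
  (forall k x y u v, rel x u -> rel y v -> rel (k *: x + y) (k *: u + v)) ->
  (forall x, rel x 0 -> b x x = 0) ->
  (forall i, exists u, rel (w i) u) -> ~ orthonormal w.
Proof.
move=> relD rel0 /choice[A Aw] ow.
pose M := \matrix_i A i.
have [u uM u0] : exists2 u : 'rV[R]_n.+1, u *m M = 0 & u != 0.
  have : ~~ row_free M by rewrite /row_free neq_ltn ltnS rank_leq_col.
  rewrite -kermx_eq0 => /rowV0Pn[u /sub_kermxP uM u0]; by exists u.
have rel00 : rel 0 0.
  have := relD (-1) _ _ _ _ (Aw ord0) (Aw ord0).
  by rewrite !scaleN1r !addNr.
have : rel (\sum_i u 0 i *: w i) (\sum_i u 0 i *: A i).
  by apply: (big_rec2 rel) => // i x y _; exact: relD.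
have -> : \sum_i u 0 i *: A i = 0.
  apply: etrans uM; rewrite mulmx_sum_row.
  by apply: eq_bigr => i _; rewrite rowK.
move=> /rel0 null; move/eqP: u0; apply; apply/rowP => j; rewrite mxE.
have := si_null_l hb (x := \sum_i u 0 i *: w i) (y := w j) I I null.
rewrite si_suml (bigD1 j)//= ow eqxx mulr1 big1 ?addr0// => i ij.
by rewrite ow (negbTE ij) mulr0.
Qed.

End inverse_inequality.

(** * The forms of the problem *)

Lemma semi_inner_sum (R : realType) (I : finType) (V : lmodType R) (S : set V)
    (b : V -> V -> R) : semi_inner S b ->
  semi_inner [set v : I -> V | forall i, S (v i)]
    (fun v w => \sum_i b (v i) (w i)).
Proof.
move=> hb; split=> [k x y Sx Sy i|k x y z Sx Sy Sz|x y|x].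
- exact: (si_closed hb).
- rewrite mulr_sumr -big_split /=; apply: eq_bigr => i _.
  by rewrite -(si_linear hb).
- by apply: eq_bigr => i _; rewrite (si_sym hb).
- by apply: sumr_ge0 => i _; exact: (si_ge0 hb).
Qed.

Lemma semi_inner_comap (R : realType) (U V : lmodType R) (S : set V)
    (b : V -> V -> R) (f : U -> V) : semi_inner S b ->
  (forall k x y, f (k *: x + y) = k *: f x + f y) -> (forall x, S (f x)) ->
  semi_inner setT (fun x y => b (f x) (f y)).
Proof.
move=> hb flin Sf; split=> [//|k x y z _ _ _|x y|x].
- by rewrite flin (si_linear hb).
- exact: (si_sym hb).
- exact: (si_ge0 hb).
Qed.

Section forms.
Variables (R : realType) (n : nat) (D : set 'rV[R]_n).
Local Notation pt := 'rV[R]_n.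
Local Notation H1 := (H1 D).

Lemma L2_semi_inner : semi_inner (L2 D) (@L2inner R n D).
Proof.
split=> [k x y Lx Ly|k x y z Lx Ly Lz|x y|x].
- by have [_ /(_ k x y)] := L2_submod_closed D; rewrite !inE; apply.
- have zE h : L2inner D h z = L2inner D h (z \_ D).
    by apply: eq_Rintegral => t tD; rewrite patchE tD.
  by rewrite !zE; exact: L2innerDZ.
- by apply: eq_Rintegral => t _; rewrite mulrC.
- by apply: Rintegral_ge0 => t _; rewrite -expr2 sqr_ge0.
Qed.

Lemma L2_H1fun (v : H1) : L2 D v.
Proof. by case: v => v Hv; have /asboolP[] := Hv. Qed.

Lemma L2_grad (v : H1) i : L2 D (grad v i).
Proof. by case: v => v Hv; have /asboolP[_ /(_ i)[]] := Hv. Qed.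

Lemma grad_semi_inner : semi_inner setT
  (fun v w : H1 => L2vinner D (grad v) (grad w)).
Proof.
apply: (semi_inner_comap (f := @grad R n D) (semi_inner_sum 'I_n L2_semi_inner)) => //.
by move=> v i; exact: L2_grad.
Qed.

Lemma H1fun_semi_inner : semi_inner setT (fun v w : H1 => L2inner D v w).
Proof.
apply: (semi_inner_comap (f := @H1fun R n D) L2_semi_inner) => //.
exact: L2_H1fun.
Qed.

Lemma eps_linear (k : R) (v w : 'I_n -> H1) :
  eps (k *: v + w) = k *: eps v + eps w.
Proof.
apply/funext => i; apply/funext => j; apply/funext => x.
have gE i' j' : grad ((k *: v + w) i') j' x =
  k * grad (v i') j' x + grad (w i') j' x by [].
have -> : (k *: eps v + eps w) i j x = k * eps v i j x + eps w i j x by [].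
by rewrite /eps !gE; ring.
Qed.

Lemma L2_eps (v : 'I_n -> H1) i j : L2 D (eps v i j).
Proof.
have hb := L2_semi_inner.
exact: (si_memZ hb 2^-1 (si_memD hb (L2_grad (v i) j) (L2_grad (v j) i))).
Qed.

Lemma L2t_semi_inner : semi_inner
  [set A : 'I_n -> 'I_n -> pt -> R | forall i j, L2 D (A i j)] (@L2tinner R n D n).
Proof. exact: (semi_inner_sum 'I_n (semi_inner_sum 'I_n L2_semi_inner)). Qed.

Lemma eps_semi_inner : semi_inner setT
  (fun v w : 'I_n -> H1 => L2tinner D (eps v) (eps w)).
Proof.
apply: (semi_inner_comap (f := @eps R n D) L2t_semi_inner).
  exact: eps_linear.
exact: L2_eps.
Qed.

Lemma divB (v w : 'I_n -> H1) : div (v - w) = div v - div w.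
Proof.
apply/funext => x; have -> : (div v - div w) x = div v x - div w x by [].
by rewrite /div -sumrB.
Qed.

Lemma L2_sum (I : Type) (s : seq I) (f : I -> pt -> R) :
  (forall i, L2 D (f i)) -> L2 D (\sum_(i <- s) f i).
Proof.
move=> Lf; apply: (big_ind (L2 D)) => // [|g h].
  by have [+ _] := L2_submod_closed D; rewrite inE.
exact: (si_memD L2_semi_inner).
Qed.

Lemma div_sum (v : 'I_n -> H1) : div v = \sum_i eps v i i.
Proof.
apply/funext => x; rewrite fct_sumE; apply: eq_bigr => i _.
by rewrite /eps; field.
Qed.

Lemma L2_div (v : 'I_n -> H1) : L2 D (div v).
Proof. by rewrite div_sum; apply: L2_sum => i; exact: L2_eps. Qed.

(** The divergence is the trace of the symmetric gradient. *)
Lemma L2norm_div (v : 'I_n -> H1) :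
  nrm (@L2inner R n D) (div v) <= n%:R * nrm (@L2tinner R n D n) (eps v).
Proof.
have hb := L2_semi_inner.
rewrite div_sum.
have -> : n%:R * nrm (@L2tinner R n D n) (eps v) =
    \sum_(i < n) nrm (@L2tinner R n D n) (eps v).
  by rewrite sumr_const card_ord mulr_natl.
suff H (s : seq 'I_n) : nrm (@L2inner R n D) (\sum_(i <- s) eps v i i) <=
    \sum_(i <- s) nrm (@L2tinner R n D n) (eps v) by [].
elim: s => [|i s IH].
  have L0 : L2 D (\sum_(i <- [::]) eps v i i) by apply: L2_sum => i; exact: L2_eps.
  rewrite !big_nil in L0 *.
  by rewrite -(scale0r (0 : pt -> R)) (nrmZ hb _ L0) normr0 mul0r.
have Ls : L2 D (\sum_(i <- s) eps v i i) by apply: L2_sum => j; exact: L2_eps.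
rewrite !big_cons; apply: le_trans (nrmD hb (L2_eps v i i) Ls) _.
apply: lerD => //; apply: ler_wsqrtr.
have ge0 A : 0 <= L2inner D A A := si_ge0 hb A.
rewrite /L2tinner (bigD1 i)//= /L2vinner (bigD1 i)//= -addrA lerDl.
apply: addr_ge0; first exact: sumr_ge0.
by apply: sumr_ge0 => j _; apply: sumr_ge0.
Qed.

(** [eps v] is the mean of the gradient and its transpose, which have the same
    norm. *)
Lemma le_eps_seminorm (v : 'I_n -> H1) :
  L2tinner D (eps v) (eps v) <= L2tinner D (fun i => grad (v i)) (fun i => grad (v i)).
Proof.
have ht := L2t_semi_inner.
set G := fun i => grad (v i).
pose G' i j := G j i.
have SG : [set A : 'I_n -> 'I_n -> pt -> R | forall i j, L2 D (A i j)] G.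
  by move=> i j; exact: L2_grad.
have SG' : [set A : 'I_n -> 'I_n -> pt -> R | forall i j, L2 D (A i j)] G'.
  by move=> i j; exact: L2_grad.
have G'E : L2tinner D G' G' = L2tinner D G G.
  by rewrite /L2tinner /L2vinner exchange_big.
have SGG' := si_memD ht SG SG'.
have -> : eps v = 2^-1 *: (G + G') by [].
rewrite (siZl ht _ SGG' (si_memZ ht _ SGG')) (siZr ht _ SGG' SGG').
have := siDD_le ht SG SG'; rewrite G'E; lra.
Qed.

Lemma L2inner_ae0 (f : pt -> R) : L2 D f ->
  {ae leb R n, forall x, D x -> f x = 0} -> L2inner D f f = 0.
Proof.
move=> Lf f0; rewrite /L2inner Rintegral_mkcond /Rintegral.
rewrite (@ae_eq_integral _ _ _ _ setT (cst 0%E)) ?integral0//=.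
- have mf : measurable_fun setT (f \_ D).
    by have := Lf; rewrite /L2/= inE => /andP[]; rewrite inE.
  apply/measurable_EFinP.
  rewrite (_ : _ \_ D = (f \_ D) \* (f \_ D)); first exact: measurable_funM.
  by apply/funext => x; rewrite /= !patchE; case: ifP => // _; rewrite mul0r.
- move: f0; apply: filterS => x f0 _ /=.
  by rewrite patchE; case: ifPn => // /set_mem /f0 ->; rewrite mul0r.
Qed.

End forms.

(** * Equality almost everywhere and boundary conditions *)

Section ae.
Variables (R : realType) (n : nat) (D : set 'rV[R]_n).
Hypothesis oD : open D.
Local Notation pt := 'rV[R]_n.

Lemma measurable_open_rV : measurable (D : set pt).
Proof. exact: sub_sigma_algebra. Qed.

Lemma L2_measurable (f : pt -> R) : L2 D f -> measurable_fun D f.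
Proof.
rewrite /L2/= inE => /andP[]; rewrite inE/= => mf _.
exact/(measurable_restrictT f measurable_open_rV).
Qed.

Lemma L2norm_ae (f f' g : pt -> R) : L2 D f -> L2 D f' -> continuous g ->
  L2_eq D f f' -> L2norm D (f - g) = L2norm D (f' - g).
Proof.
move=> Lf Lf' cg ff'; rewrite /L2norm /L2inner; congr (Num.sqrt (fine _)).
have mD := measurable_open_rV.
have mg : measurable_fun D g.
  by apply: measurable_funTS; exact: continuous_measurable_rV.
have mh h : L2 D h -> measurable_fun D (fun x => ((h - g) x * (h - g) x)%:E).
  move=> Lh; apply/measurable_EFinP; apply: measurable_funM;
    by apply: measurable_funB => //; exact: L2_measurable.
apply: ae_eq_integral => //; [exact: mh|exact: mh|].
move: ff'; apply: filterS => x ff' Dx.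
have -> : (f - g) x = f x - g x by [].
by have -> : (f' - g) x = f' x - g x by []; rewrite ff'.
Qed.

End ae.

(** The approximating smooth functions of a trace only see the representatives
    through L^2 norms. *)
Lemma H1_0D_ae (R : realType) (d : nat) (Omega : mixed_domain R d)
    (v w : H1 Omega) : H1_0D Omega v -> H1_eq v w -> H1_0D Omega w.
Proof.
move=> [g [Lg [W [sW vW gW bW]]] g0] [vw gvw]; exists g => //.
have oO : open (dom Omega) := dom_open (p := Omega).
split=> //; exists W; split=> // [|i].
- have -> // : (fun m => L2norm Omega ((w : 'rV[R]_d -> R) - W m)) =
      (fun m => L2norm Omega ((v : 'rV[R]_d -> R) - W m)).
  apply/funext => m; apply/esym.
  by apply: L2norm_ae => //; [exact: L2_H1fun|exact: L2_H1fun|have [] := sW m 0].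
- have -> // : (fun m => L2norm Omega (grad w i - partial i (W m))) =
      (fun m => L2norm Omega (grad v i - partial i (W m))).
  apply/funext => m; apply/esym.
  apply: L2norm_ae => //; [exact: L2_grad|exact: L2_grad|].
  by have [_ /(_ i)[_ []]] := sW m 1.
Qed.

(** * Finite elements *)

Section elements.
Variables (R : realType) (d : nat) (Omega : mixed_domain R d).
Variable K : simplices R d d.
Hypothesis KO : triangulation_of K (closure Omega).
Local Notation pt := 'rV[R]_d.
Local Notation H1 := (H1 Omega).

Lemma polyfunB m (f g : pt -> R) :
  polyfun m f -> polyfun m g -> polyfun m (fun x => f x - g x).
Proof.
move=> [cf ->] [cg ->]; exists (fun a => cf a - cg a); apply/funext => x.
by rewrite -sumrB; apply: eq_bigr => a _; rewrite mulrBl.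
Qed.

Lemma Z_hB l (q q' : pt -> R) :
  Z_h Omega l K q -> Z_h Omega l K q' -> Z_h Omega l K (q - q').
Proof.
move=> [Lq pq] [Lq' pq']; split; first exact: (si_memB (L2_semi_inner Omega)).
move=> i; have [f pf qf] := pq i; have [f' pf' qf'] := pq' i.
exists (fun x => f x - f' x); first exact: polyfunB.
move: qf qf'; apply: filterS2 => x qf qf' Kx.
by have -> : (q - q') x = q x - q' x by []; rewrite qf// qf'.
Qed.

Section shape.
Variable m : nat.
Local Notation index := ('I_(ncells K) * {ffun 'I_d -> 'I_m.+1})%type.

(** A point on an interface is attributed to one of the cells that contain it,
    so that a continuous piecewise polynomial function is a combination of the
    shape functions at every point of the domain. *)
Definition shape (j : index) (x : pt) : R :=
  if ([pick i | `[< simplex (cell K i) x >]] == Some j.1) && (\sum_i j.2 i <= m)%N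
  then \prod_i x 0 i ^+ j.2 i else 0.

Definition expansion (v : H1) (u : 'rV[R]_#|{: index}|) :=
  forall x, dom Omega x -> v x = \sum_j u 0 j * shape (enum_val j) x.

Lemma expansionD (k : R) (v w : H1) uv uw :
  expansion v uv -> expansion w uw -> expansion (k *: v + w) (k *: uv + uw).
Proof.
move=> ev ew x Ox.
have -> : H1fun (k *: v + w) x = k * v x + w x by [].
rewrite ev// ew// mulr_sumr -big_split; apply: eq_bigr => j _.
by rewrite !mxE mulrDl mulrA.
Qed.

Lemma expansion0 (v : H1) : expansion v 0 -> L2inner Omega v v = 0.
Proof.
move=> ev; rewrite /L2inner (@eq_Rintegral _ _ _ _ _ (cst 0)).
  by rewrite /Rintegral integral0.
move=> x /set_mem Ox; rewrite ev// big1 ?mul0r// => j _.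
by rewrite mxE mul0r.
Qed.

Lemma expansion_conforming (v : H1) :
  conforming_space Omega m K v -> exists u, expansion v u.
Proof.
move=> [_ _ vp].
have /choice[C CP] i : exists c : {ffun 'I_d -> 'I_m.+1} -> R,
    forall x, dom Omega x -> simplex (cell K i) x ->
      v x = \sum_(a : {ffun 'I_d -> 'I_m.+1} | (\sum_i a i <= m)%N)
        c a * \prod_i x 0 i ^+ a i.
  by have [f [c ->] vf] := vp i; exists c.
exists (\row_j C (enum_val j).1 (enum_val j).2) => x Ox.
under eq_bigr do rewrite mxE.
rewrite -(big_enum_val (fun j : index => C j.1 j.2 * shape j x)) /=.
rewrite /shape; case: pickP => [i0 /asboolP xi0|nox]; last first.
  have [_ _ cover] := KO.
  have : closure Omega x by exact: subset_closure.
  by rewrite -cover => -[i _ xi]; have := nox i; rewrite asboolT.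
rewrite (CP i0 x Ox xi0).
rewrite (eq_bigl xpredT)// -(pair_bigA _ (fun i a => C i a *
  (if (Some i0 == Some i) && (\sum_i a i <= m)%N then \prod_i x 0 i ^+ a i else 0))).
rewrite (bigD1 i0)//= [X in _ + X]big1 ?addr0 => [|i ii0].
  rewrite [in LHS]big_mkcond; apply: eq_bigr => a _; rewrite eqxx/=.
  by case: ifP => // _; rewrite mulr0.
apply: big1 => a _; rewrite (_ : Some i0 == Some i = false) ?mulr0//.
by apply/negP => /eqP[i0i]; rewrite i0i eqxx in ii0.
Qed.

End shape.
End elements.

(** * Bounds for the discrete solutions *)

(** The inverse inequality holds on all the finite element space, but there it
    requires that a weak gradient of a null function be null. Along a family of
    elements whose gradient form is represented by square integrable functions
    [k], this is immediate: the gradient form of a null element with any member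
    vanishes. The inequality is proved on the space [W] of the elements for which
    that argument works. *)
Lemma curve_inverse_inequality (R : realType) (d : nat) (Omega : mixed_domain R d)
    (K : simplices R d d) (m : nat) (J : Type) (A : set J) (x : J -> H1 Omega)
    (k : J -> 'rV[R]_d -> R) :
  (forall i, A i -> exists u, @expansion R d Omega K m (x i) u) ->
  (forall i, A i -> L2 Omega (k i)) ->
  (forall i j, A i -> A j ->
    L2vinner Omega (grad (x i)) (grad (x j)) = L2inner Omega (k i) (x j)) ->
  exists C, forall i j, A i -> A j ->
    L2vinner Omega (grad (x i - x j)) (grad (x i - x j)) <=
    C * L2inner Omega (x i - x j : H1 Omega) (x i - x j : H1 Omega).
Proof.
move=> xe Lk ck.
have hL := L2_semi_inner Omega.
have hb := H1fun_semi_inner Omega; have hc := grad_semi_inner Omega.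
pose Z0 := [set z : H1 Omega | (exists u, @expansion R d Omega K m z u) /\
  forall i, A i -> L2vinner Omega (grad (x i)) (grad z) = L2inner Omega (k i) z].
have ZD a v w : Z0 v -> Z0 w -> Z0 (a *: v + w).
  move=> [[u vu] cv] [[u' wu'] cw]; split; first by exists (a *: u + u'); exact: expansionD.
  move=> i Ai; rewrite (si_sym hc) (si_linear hc)// !(si_sym hc _ (x i)) cv// cw//.
  rewrite [RHS](si_sym hL).
  have -> : H1fun (a *: v + w) = a *: H1fun v + H1fun w by [].
  rewrite (si_linear hL _ (L2_H1fun v) (L2_H1fun w) (Lk i Ai)).
  by rewrite !(si_sym hL _ (k i)).
pose W := [set w : H1 Omega | Z0 w /\ forall z, Z0 z -> L2inner Omega z z = 0 ->
  L2vinner Omega (grad w) (grad z) = 0].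
have xW i : A i -> W (x i).
  move=> Ai; split; first by split; [exact: xe|move=> j Aj; exact: ck].
  move=> z [_ cz] z0; rewrite cz// (si_sym hL).
  exact: (si_null_l hL (L2_H1fun z) (Lk i Ai) z0).
have WD a v w : W v -> W w -> W (a *: v + w).
  move=> [Zv v0] [Zw w0]; split; first exact: ZD.
  by move=> z Zz z0; rewrite (si_linear hc)// v0// w0// mulr0 addr0.
have [C _ CP] : exists2 C, 0 <= C & forall w, W w ->
    L2vinner Omega (grad w) (grad w) <= C * L2inner Omega w w.
  apply: (inverse_inequality hb hc WD).
    by move=> w [Zw w0]; exact: w0.
  move=> w Ww; apply: (no_orthonormal hb (rel := @expansion R d Omega K m)).
  - by move=> *; exact: expansionD.
  - by move=> v; exact: expansion0.
  - by move=> i; have [[]] := Ww i.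
exists C => i j Ai Aj; apply: CP.
by rewrite addrC -scaleN1r; apply: WD; exact: xW.
Qed.

Lemma le_combination (R : realType) (z A x m k C : R) (J : \bar R) :
  z <= 2 * A + m * x -> (x%:E <= k%:E * J)%E -> 0 <= A -> (0 <= J)%E ->
  0 <= m -> 0 <= k -> 2 <= C -> m * k <= C -> (z%:E <= C%:E * (A%:E + J))%E.
Proof.
move=> zA xJ A0 J0 m0 k0 C2 mkC.
have C0 : 0 <= C by lra.
rewrite ge0_muleDr//; apply: (@le_trans _ _ ((2 * A)%:E + (m * x)%:E)%E).
  by rewrite -EFinD lee_fin.
apply: leeD; first by rewrite -EFinM lee_fin ler_wpM2r.
rewrite EFinM; apply: (@le_trans _ _ (m%:E * (k%:E * J))%E).
  by apply: lee_wpmul2l => //; rewrite lee_fin.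
by rewrite muleA -EFinM; apply: lee_wpmul2r => //; rewrite lee_fin.
Qed.

Lemma le_sqr_quotient (R : realFieldType) (C x m y : R) :
  0 < C -> 0 <= x -> 0 <= m -> 0 <= y -> C * x <= m * y ->
  x ^+ 2 <= (m / C) ^+ 2 * y ^+ 2.
Proof.
move=> C0 x0 m0 y0 h; rewrite -exprMn; apply: lerXn2r; rewrite ?nnegrE//.
  by rewrite mulr_ge0// divr_ge0// ltW.
by rewrite mulrAC ler_pdivlMr// mulrC.
Qed.

(** The inf-sup condition turns the momentum balance into a bound of the pressure
    by the strain, with the constant of the condition only. *)
Lemma inf_sup_bound (R : realType) (d : nat) (Omega : mixed_domain R d) (C m : R)
    (U : set ('I_d -> H1 Omega)) (Z : set ('rV[R]_d -> R)) (x : 'I_d -> H1 Omega) w :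
  0 < C -> 0 <= m -> inf_sup C U Z -> Z w ->
  (forall v, U v -> m * L2tinner Omega (eps x) (eps v) = L2inner Omega w (div v)) ->
  L2norm Omega w ^+ 2 <= (m / C) ^+ 2 * L2tnorm Omega (eps x) ^+ 2.
Proof.
move=> C0 m0 infsup Zw eq_w.
apply: le_sqr_quotient => //; [exact: sqrtr_ge0|exact: sqrtr_ge0|].
rewrite -lee_fin; apply: le_trans (infsup w Zw) _.
apply: ge_ereal_sup => _ [v [Uv _ ->]]; rewrite lee_fin -eq_w//.
have aAB : L2tinner Omega (eps x) (eps v) <=
    L2tnorm Omega (eps x) * L2tnorm Omega (eps v).
  exact: (le_si (eps_semi_inner Omega) (x := x) (y := v)).
have BS : L2tnorm Omega (eps v) <= H1_seminorm v.
  exact/ler_wsqrtr/le_eps_seminorm.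
have S0 : 0 <= H1_seminorm v by exact: sqrtr_ge0.
have A0 : 0 <= L2tnorm Omega (eps x) by exact: sqrtr_ge0.
move: (L2tnorm _ (eps x)) (L2tnorm _ (eps v)) (H1_seminorm v) aAB BS S0 A0.
move: (L2tinner _ _ _) => a A B S aAB BS S0 A0.
have [->|SN] := eqVneq S 0; first by rewrite invr0 mulr0 mulr_ge0.
have {}S0 : 0 < S by rewrite lt_neqAle eq_sym SN.
rewrite ler_pdivrMr// -mulrA; apply: ler_wpM2l => //.
by apply: (le_trans aAB); apply: ler_wpM2l.
Qed.

Lemma le_error_combination (R : realFieldType) (mu C a1 a2 a3 b1 b2 b3 : R) :
  0 < mu -> 0 < C -> a3 <= 2 * a1 + 2 * a2 -> b3 <= 2 * b1 + 2 * b2 ->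
  b2 <= (2 * mu / C) ^+ 2 * a2 ->
  mu * a3 + b3 <= 2 * (mu * a1 + b1) + 2 * (1 + 4 * mu / C ^+ 2) * (mu * a2).
Proof.
move=> mu0 C0 ha hb hab; have h := ler_wpM2l (ltW mu0) ha.
have -> : 2 * (1 + 4 * mu / C ^+ 2) * (mu * a2) =
    2 * (mu * a2) + 2 * ((2 * mu / C) ^+ 2 * a2) by field; exact: lt0r_neq0.
lra.
Qed.

Unset Implicit Arguments.

Theorem theorem3p1 (R : realType) (d : nat) (d23 : d = 2%N \/ d = 3%N)
  (Omega : mixed_domain R d) (T mu lambda kappa : R)
  (T_gt0 : 0 < T) (mu_gt0 : 0 < mu) (lambda_gt0 : 0 < lambda)
  (kappa_gt0 : 0 < kappa) (k l : nat) (k_ge2 : (2 <= k)%N)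
  (I : Type) (M : I -> simplices R d d)
  (M_triangulation : forall m, triangulation_of (M m) (closure Omega))
  (M_regular : regular_family M) (M_quasi_uniform : quasi_uniform_family M)
  (C0 : R) (C0_gt0 : 0 < C0)
  (M_inf_sup : forall m, inf_sup C0 (U_h Omega k (M m)) (Z_h Omega l (M m))) :
  exists2 C : R, 0 < C &
  forall (f : R -> 'I_d -> 'rV[R]_d -> R) (g : R -> 'rV[R]_d -> R)
    (beta : R -> 'I_d -> 'rV[R]_d -> R) (gamma : R -> 'rV[R]_d -> R)
    (varphi : 'I_d -> H1 Omega) (phi : H1 Omega)
    (u : R -> 'I_d -> H1 Omega) (q : R -> 'rV[R]_d -> R) (p : R -> H1 Omega)
    (q_t p_t : R -> 'rV[R]_d -> R),
  admissible_data Omega T f g beta gamma ->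
  weak_solution mu lambda kappa T f g beta gamma varphi phi u q p q_t p_t ->
  forall (m : I)
    (Qu : ('I_d -> H1 Omega) -> ('rV[R]_d -> R) -> 'I_d -> H1 Omega)
    (Qq : ('I_d -> H1 Omega) -> ('rV[R]_d -> R) -> 'rV[R]_d -> R)
    (Qp : H1 Omega -> H1 Omega)
    (uh : R -> 'I_d -> H1 Omega) (qh : R -> 'rV[R]_d -> R) (ph : R -> H1 Omega)
    (qh_t ph_t : R -> 'rV[R]_d -> R),
  stokes_projection mu (U_h Omega k (M m)) (Z_h Omega l (M m)) Qu Qq ->
  elliptic_projection (P_h Omega k (M m)) Qp ->
  semidiscrete_solution mu lambda kappa T f g beta gamma varphi phi
    (U_h Omega k (M m)) (Z_h Omega l (M m)) (P_h Omega k (M m))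
    Qu Qq Qp uh qh ph qh_t ph_t ->
  let e_u t := u t - uh t in
  let e_q t := q t - qh t in
  let e_p t := p t - ph t in
  let eta_u t := u t - Qu (u t) (q t) in
  let eta_q t := q t - Qq (u t) (q t) in
  let eta_p t := p t - Qp (p t) in
  forall eta_q_t eta_p_t : R -> 'rV[R]_d -> R,
  time_derivative Omega T eta_q eta_q_t ->
  time_derivative Omega T (fun t => H1fun (eta_p t)) eta_p_t ->
  forall t, 0 < t <= T ->
  let J := (\int[lebesgue_measure]_(s in `[0%R, t])
              (L2norm Omega (eta_q_t s - eta_p_t s)%R ^+ 2)%:E)%E in
  ((mu * L2tnorm Omega (eps (e_u t)) ^+ 2 + L2norm Omega (e_q t) ^+ 2)%:E <=
   C%:E * ((mu * L2tnorm Omega (eps (eta_u t)) ^+ 2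
            + L2norm Omega (eta_q t) ^+ 2)%:E + J))%E
  /\
  ((kappa * L2vnorm Omega (grad (e_p t)) ^+ 2)%:E <=
   C%:E * ((kappa * L2vnorm Omega (grad (eta_p t)) ^+ 2)%:E + J))%E.
Proof.
set hL := L2_semi_inner Omega.
have ha := eps_semi_inner Omega; have hc := grad_semi_inner Omega.
set kappa2 := (2 * lambda)^-1.
have m20 : 0 <= 2 * mu by rewrite mulr_ge0// ltW.
have k20 : 0 <= kappa2 by rewrite invr_ge0 mulr_ge0// ltW.
have eT0 : 0 <= expR T * kappa2 by rewrite mulr_ge0 ?expR_ge0.
(* mU is the factor of mu |eps xu|^2 once the inf-sup condition has absorbed the
   error of q. *)
pose mU := 2 * (1 + 4 * mu / C0 ^+ 2).
have mU0 : 0 <= mU.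
  by rewrite mulr_ge0// addr_ge0// divr_ge0 ?sqr_ge0// mulr_ge0// ltW.
pose C := 2 + mU * (expR T * kappa2) + 2 * kappa2.
have CU0 : 0 <= mU * (expR T * kappa2) by rewrite mulr_ge0.
have CP0 : 0 <= 2 * kappa2 by rewrite mulr_ge0.
have C2 : 2 <= C by rewrite /C; lra.
have CU : mU * (expR T * kappa2) <= C by rewrite /C; lra.
have CP : 2 * kappa2 <= C by rewrite /C; lra.
exists C; first by rewrite (lt_le_trans _ C2).
move=> f g beta gamma varphi phi u q p q_t p_t _ [Wmem [Wq Wp] [Wu0 Wp0 Wq0] Weq].
move=> m Qu Qq Qp uh qh ph qh_t ph_t [St Sta] [El Ela].
move=> [Smem [Sq Sp] [Su0 Sq0 Sp0] Seq].
move=> e_u e_q e_p eta_u eta_q eta_p eta_q_t eta_p_t dEq dEp t tT J.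
have tr : True by [].
have KO := M_triangulation m.
have U_D v : U_h Omega k (M m) v -> vH1_0D Omega v by move=> Uv i; have [] := Uv i.
have pos_nng s : 0 < s <= T -> 0 <= s <= T by case/andP => /ltW -> ->.
(* The differences between projections and scheme. xq and hp are written through
   the given errors, so that their time derivatives are combinations of the given
   ones. *)
pose xu s := Qu (u s) (q s) - uh s.
pose xp s := Qp (p s) - ph s.
pose xq s := q s - qh s - eta_q s.
pose xq' s := q_t s - qh_t s - eta_q_t s.
pose hp s : 'rV[R]_d -> R := (p s : 'rV[R]_d -> R) - ph s - eta_p s.
pose hp' s := p_t s - ph_t s - eta_p_t s.
pose r s : 'rV[R]_d -> R := q s - (p s : 'rV[R]_d -> R) - (qh s - (ph s : 'rV[R]_d -> R)).
pose r' s := q_t s - p_t s - (qh_t s - ph_t s).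
have dq : si_derivative T (L2 Omega) (@L2inner R d Omega) xq xq'.
  exact: (si_derivativeB hL (si_derivativeB hL Wq Sq) dEq).
have dp : si_derivative T (L2 Omega) (@L2inner R d Omega) hp hp'.
  exact: (si_derivativeB hL (si_derivativeB hL Wp Sp) dEp).
have dr : si_derivative T (L2 Omega) (@L2inner R d Omega) r r'.
  exact: (si_derivativeB hL (si_derivativeB hL Wq Wp) (si_derivativeB hL Sq Sp)).
have xqE s : xq s = Qq (u s) (q s) - qh s.
  by apply/funext => x; rewrite /xq /eta_q !fctE; ring.
have hpE s : hp s = H1fun (xp s).
  apply/funext => x.
  have -> : hp s x = p s x - ph s x - (p s x - Qp (p s) x) by [].
  have -> : H1fun (xp s) x = Qp (p s) x - ph s x by [].
  by ring.
have Zxq s : 0 <= s <= T -> Z_h Omega l (M m) (xq s).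
  move=> sT; have [Hu Hq _] := Wmem s sT; have [_ Zq _] := Smem s sT.
  by have [_ ZQ _ _] := St _ _ Hu Hq; rewrite xqE; exact: Z_hB.
have Lxq s : 0 <= s <= T -> L2 Omega (xq s) by move=> /Zxq[].
(* The data cancel between the two problems. The equations are linear in the test
   function and so hold for differences of test functions (eq1', eu, ep). *)
have eq1 s v : 0 < s <= T -> U_h Omega k (M m) v ->
    2 * mu * L2tinner Omega (eps (xu s)) (eps v) = L2inner Omega (xq s) (div v).
  move=> sT Uv; have sT' := pos_nng s sT.
  have [Hu Hq _] := Wmem s sT'; have [_ [Lqh _] _] := Smem s sT'.
  have [_ [LQ _] st _] := St _ _ Hu Hq.
  have [w1 _ _] := Weq s sT; have [s1 _ _] := Seq s sT.
  rewrite xqE (siBl hL LQ Lqh (L2_div v)).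
  rewrite /xu (siBl ha (x := Qu (u s) (q s)) (y := uh s) (z := v))//.
  have := st v Uv; rewrite (w1 v (U_D v Uv)) -(s1 v Uv); lra.
have eq1' s s' : 0 < s <= T -> 0 < s' <= T ->
    2 * mu * L2tinner Omega (eps (xu s)) (eps (xu s')) =
    L2inner Omega (xq s) (div (xu s')).
  move=> sT sT1; have sT1' := pos_nng s' sT1.
  have [Hu Hq _] := Wmem s' sT1'; have [UQ _ _ _] := St _ _ Hu Hq.
  have [Uuh _ _] := Smem s' sT1'.
  rewrite {2}/xu (siBr ha (x := Qu (u s') (q s')) (y := uh s') (z := xu s))//.
  rewrite /xu divB (siBr hL (L2_div _) (L2_div _) (Lxq s (pos_nng s sT))).
  by rewrite mulrBr !eq1.
have eq2 s w : 0 < s <= T -> Z_h Omega l (M m) w ->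
    L2inner Omega (r s) w = - lambda * L2inner Omega (div (xu s)) w.
  move=> sT Zw; have sT' := pos_nng s sT; have Lw : L2 Omega w by case: Zw.
  have [Hu Hq _] := Wmem s sT'; have [_ [Lqh _] _] := Smem s sT'.
  have [_ _ _ st] := St _ _ Hu Hq.
  have [_ w2 _] := Weq s sT; have [_ s2 _] := Seq s sT.
  have Lp := L2_H1fun (p s); have Lph := L2_H1fun (ph s).
  have L1 := si_memB hL Hq Lp; have L2' := si_memB hL Lqh Lph.
  have := w2 w Lw; have := s2 w Zw; have := st w Zw.
  rewrite (siZl hL _ L1 Lw) (siZl hL _ L2' Lw) !(si_sym hL w).
  rewrite /r (siBl hL L1 L2' Lw) /xu divB (siBl hL (L2_div _) (L2_div _) Lw).
  move=> -> h1 h2.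
  have l0 : lambda != 0 by exact: lt0r_neq0.
  have {}h1 : L2inner Omega (div (uh s)) w =
     - (lambda^-1 * L2inner Omega (qh s - (ph s : 'rV[R]_d -> R)) w) by lra.
  have {}h2 : L2inner Omega (div (u s)) w =
     - (lambda^-1 * L2inner Omega (q s - (p s : 'rV[R]_d -> R)) w) by lra.
  by rewrite h1 h2; field.
have eu s s' : 0 < s <= T -> 0 < s' <= T ->
    2 * mu * lambda * L2tinner Omega (eps (xu s)) (eps (xu s')) =
    - L2inner Omega (r s') (xq s).
  move=> sT sT'; rewrite eq2//; last exact/Zxq/pos_nng.
  by rewrite (si_sym hL) -eq1'//; ring.
have eq3 s w : 0 < s <= T -> P_h Omega k (M m) w ->
    kappa * L2vinner Omega (grad (xp s)) (grad w) = lambda^-1 * L2inner Omega (r' s) w.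
  move=> sT Pw; have sT' := pos_nng s sT.
  have [_ _ Hp] := Wmem s sT'; have [_ el] := El _ Hp.
  have [_ _ w3] := Weq s sT; have [_ _ s3] := Seq s sT.
  have HwD : H1_0D Omega w by case: Pw.
  have Lw := L2_H1fun w.
  have [[Lq _] [Lp _]] : (L2 Omega (q_t s) /\ True) /\ (L2 Omega (p_t s) /\ True).
    by have [_ _ /(_ s sT)[? _]] := Wq; have [_ _ /(_ s sT)[? _]] := Wp.
  have [[Lqh _] [Lph _]] : (L2 Omega (qh_t s) /\ True) /\ (L2 Omega (ph_t s) /\ True).
    by have [_ _ /(_ s sT)[? _]] := Sq; have [_ _ /(_ s sT)[? _]] := Sp.
  have L1 := si_memB hL Lq Lp; have L2' := si_memB hL Lqh Lph.
  have := w3 w HwD; rewrite -(s3 w Pw).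
  rewrite (siZl hL _ L1 Lw) (siZl hL _ L2' Lw) /r' (siBl hL L1 L2' Lw).
  rewrite /xp (siBl hc (x := Qp (p s)) (y := ph s) (z := w))// el//; lra.
have ep s s' : 0 < s <= T -> 0 < s' <= T ->
    kappa * L2vinner Omega (grad (xp s)) (grad (xp s')) =
    lambda^-1 * L2inner Omega (r' s) (hp s').
  move=> sT sT'; have [_ _ Pp] := Smem s' (pos_nng s' sT').
  have [_ _ Hp] := Wmem s' (pos_nng s' sT'); have [PQ _] := El _ Hp.
  have Lr' : L2 Omega (r' s) by have [_ _ /(_ s sT)[]] := dr.
  rewrite hpE {2}/xp (siBr hc (x := Qp (p s')) (y := ph s') (z := xp s))//.
  have -> : H1fun (xp s') = (Qp (p s') : 'rV[R]_d -> R) - ph s' by [].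
  by rewrite (siBr hL (L2_H1fun _) (L2_H1fun _) Lr') !mulrBr !eq3.
(* At time 0 both projections are taken at the initial data, up to null sets. *)
have T00 : 0 <= (0 : R) <= T by rewrite lexx ltW.
have [Hu0 Hq0 Hp0] := Wmem 0 T00.
have Lq0 : L2 Omega (q0 lambda varphi phi).
  rewrite /q0 addrC; apply: (si_memB hL); first exact: L2_H1fun.
  exact/(si_memZ hL)/L2_div.
have Hvarphi : vH1_0D Omega varphi by move=> i; exact: H1_0D_ae (Hu0 i) (Wu0 i).
have Hphi : H1_0D Omega phi by exact: H1_0D_ae Hp0 Wp0.
have [Su0' Sq0'] := Sta _ _ _ _ Hu0 Hvarphi Hq0 Lq0 Wu0 Wq0.
have Sp0' := Ela _ _ Hp0 Hphi Wp0.
have aeB (v w z : 'rV[R]_d -> R) : L2_eq Omega v z -> L2_eq Omega w z ->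
    {ae leb R d, forall x, dom Omega x -> (v - w) x = 0}.
  apply: filterS2 => x vz wz Ox; have -> : (v - w) x = v x - w x by [].
  by rewrite vz// wz// subrr.
have xq00 : L2inner Omega (xq 0) (xq 0) = 0.
  by apply: L2inner_ae0; [exact: Lxq|rewrite xqE; exact: aeB Sq0' Sq0].
have hp00 : L2inner Omega (hp 0) (hp 0) = 0.
  rewrite hpE; apply: L2inner_ae0; first exact: L2_H1fun.
  by have [h1 _] := Sp0'; have [h2 _] := Sp0; exact: aeB h1 h2.
have xp00 : L2vinner Omega (grad (xp 0)) (grad (xp 0)) = 0.
  rewrite /L2vinner big1// => i _; apply: L2inner_ae0; first exact: L2_grad.
  by have [_ h1] := Sp0'; have [_ h2] := Sp0; exact: aeB (h1 i) (h2 i).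
have xu00 : L2tinner Omega (eps (xu 0)) (eps (xu 0)) = 0.
  apply/eqP; rewrite eq_le (si_ge0 ha) andbT (le_trans (le_eps_seminorm _))//.
  rewrite /L2tinner /L2vinner big1// => i _; rewrite big1// => j _.
  apply: L2inner_ae0; first exact: L2_grad.
  by have [_ h1] := Su0' i; have [_ h2] := Su0 i; exact: aeB (h1 j) (h2 j).
(* Test the momentum balance with xu itself. *)
pose Ku := (d%:R / (2 * mu)) ^+ 2.
have u_le s : 0 <= s <= T ->
    L2tinner Omega (eps (xu s)) (eps (xu s)) <= Ku * L2inner Omega (xq s) (xq s).
  move=> sT; have [->|s0] := eqVneq s 0; first by rewrite xu00 xq00 mulr0.
  have {}s0 : 0 < s <= T by case/andP: sT => s0' ->; rewrite lt_neqAle eq_sym s0 s0'.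
  have := le_si hL (Lxq s sT) (L2_div (xu s)); rewrite -eq1'//.
  rewrite -(nrm_sqr ha) -(nrm_sqr hL).
  set A := nrm _ (xu s); set B := nrm _ (xq s) => h.
  have B0 : 0 <= B by exact: nrm_ge0.
  have A0 : 0 <= A by exact: nrm_ge0.
  have hA : 2 * mu * A ^+ 2 <= B * (d%:R * A).
    by apply: le_trans h _; apply: ler_wpM2l => //; exact: L2norm_div.
  have [->|AN] := eqVneq A 0; first by rewrite expr0n mulr_ge0 ?sqr_ge0.
  have {}AN : 0 < A by rewrite lt_neqAle eq_sym AN.
  have m2_gt0 : 0 < 2 * mu by rewrite mulr_gt0.
  have AB : A <= d%:R / (2 * mu) * B.
    rewrite mulrAC ler_pdivlMr// -(ler_pM2r AN).
    have -> : A * (2 * mu) * A = 2 * mu * A ^+ 2 by ring.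
    by have -> : d%:R * B * A = B * (d%:R * A) by ring.
  rewrite /Ku -exprMn; apply: lerXn2r => //; rewrite nnegrE.
  by rewrite mulr_ge0// divr_ge0// ltW.
(* Up to a factor, r' represents the gradient form of xp at positive times; at
   time 0 that form vanishes and 0 represents it. *)
have [Kp p_le] : exists Kp, forall s s', 0 <= s <= T -> 0 <= s' <= T ->
    L2vinner Omega (grad (xp s - xp s')) (grad (xp s - xp s')) <=
    Kp * L2inner Omega (hp s - hp s') (hp s - hp s').
  have [|||Kp KpP] := @curve_inverse_inequality R d Omega (M m) k.-1 R
    [set s | 0 <= s <= T] xp (fun s => if s == 0 then 0 else (kappa * lambda)^-1 *: r' s).
  - move=> s sT; have [_ _ Pp] := Smem s sT; have [_ _ Hp] := Wmem s sT; have [PQ _] := El _ Hp.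
    have [v vE] := expansion_conforming KO PQ.
    have [w wE] := expansion_conforming KO Pp.
    exists (-1 *: w + v); rewrite /xp addrC -scaleN1r; exact: expansionD.
  - move=> s sT; case: eqVneq => s0.
      by rewrite -(subrr (xq s)); apply: (si_memB hL); exact: Lxq.
    have s0' : 0 < s <= T by case/andP: sT => s0' ->; rewrite lt_neqAle eq_sym s0 s0'.
    by apply: (si_memZ hL); have [_ _ /(_ s s0')[]] := dr.
  - have Lr' s : 0 < s <= T -> L2 Omega (r' s) by move=> sT; have [_ _ /(_ s sT)[]] := dr.
    have pos s : 0 <= s <= T -> s != 0 -> 0 < s <= T.
      by move=> /andP[s0 ->] sN; rewrite lt_neqAle eq_sym sN s0.
    move=> s s' sT sT'; case: (eqVneq s 0) => [->|/(pos s sT) s0].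
      rewrite (si_null_l hc tr tr xp00) -(scale0r (xq 0)).
      by rewrite (siZl hL _ (Lxq 0 T00) (L2_H1fun (xp s'))) mul0r.
    rewrite (siZl hL _ (Lr' s s0) (L2_H1fun (xp s'))).
    have [->|/(pos s' sT') s'0] := eqVneq s' 0.
      rewrite (si_sym hc) (si_null_l hc tr tr xp00) (si_sym hL).
      rewrite (si_null_l hL (L2_H1fun _) (Lr' s s0)) ?mulr0//.
      by rewrite -hpE.
    apply: (mulfI (lt0r_neq0 kappa_gt0)); rewrite (ep s s' s0 s'0) hpE.
    by field; rewrite !lt0r_neq0.
  - by exists Kp => s s' sT sT'; rewrite !hpE; exact: KpP.
have JE : J = (\int[lebesgue_measure]_(s in `[0%R, t])
    (nrm (@L2inner R d Omega) (r' s - (xq' s - hp' s)) ^+ 2)%:E)%E.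
  apply: eq_integral => s _; congr (_ ^+ 2)%:E; rewrite /nrm /L2norm.
  have -> // : r' s - (xq' s - hp' s) = eta_q_t s - eta_p_t s.
  by apply/funext => x; rewrite /r' /xq' /hp' !fctE; ring.
have J0 : (0 <= J)%E by apply: integral_ge0 => s _; rewrite lee_fin sqr_ge0.
have EU := energy_estimate_u hL ha hc mu_gt0 lambda_gt0 kappa_gt0 dq dp dr eu ep u_le xq00 hp00 tT.
have EP := energy_estimate_p hL ha hc mu_gt0 lambda_gt0 kappa_gt0 dq dp dr eu ep p_le xp00 tT.
rewrite -JE in EU EP.
have tT' := pos_nng t tT.
have [Hu Hq _] := Wmem t tT'; have [_ [Lqh _] _] := Smem t tT'.
have [_ [LQ _] _ _] := St _ _ Hu Hq.
have Leta : L2 Omega (eta_q t) by exact: (si_memB hL).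
have normE n' (A : 'I_n' -> 'rV[R]_d -> R) : L2vnorm Omega A ^+ 2 = L2vinner Omega A A.
  exact: (nrm_sqr (semi_inner_sum 'I_n' hL)).
have tnormE (A : 'I_d -> 'I_d -> 'rV[R]_d -> R) : L2tnorm Omega A ^+ 2 = L2tinner Omega A A.
  exact: (nrm_sqr (L2t_semi_inner Omega)).
have snormE (A : 'rV[R]_d -> R) : L2norm Omega A ^+ 2 = L2inner Omega A A.
  exact: (nrm_sqr hL).
have infsup : L2norm Omega (xq t) ^+ 2 <=
    (2 * mu / C0) ^+ 2 * L2tnorm Omega (eps (xu t)) ^+ 2.
  apply: (inf_sup_bound C0_gt0 m20 (M_inf_sup m) (Zxq t tT')) => v Uv.
  exact: eq1.
rewrite snormE tnormE in infsup.
have strain_ge0 : 0 <= mu * L2tnorm Omega (eps (eta_u t)) ^+ 2 + L2norm Omega (eta_q t) ^+ 2.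
  exact: addr_ge0 (mulr_ge0 (ltW mu_gt0) (sqr_ge0 _)) (sqr_ge0 _).
have flux_ge0 := mulr_ge0 (ltW kappa_gt0) (sqr_ge0 (L2vnorm Omega (grad (eta_p t)))).
split.
- refine (le_combination _ EU strain_ge0 J0 mU0 eT0 C2 CU).
  rewrite !tnormE !snormE; refine (le_error_combination mu_gt0 C0_gt0 _ _ infsup).
    have <- : eta_u t + xu t = e_u t by rewrite /e_u /eta_u /xu addrA subrK.
    exact: (siDD_le ha).
  have <- : eta_q t + xq t = e_q t by rewrite /xq addrC subrK.
  exact: siDD_le hL _ _ Leta (Lxq t tT').
- refine (le_combination (m := 2) _ EP flux_ge0 J0 (ler0n _ 2) k20 C2 CP).
  rewrite !normE.
  have e1 : eta_p t + xp t = e_p t by rewrite /eta_p /xp addrA subrK.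
  have h1 := siDD_le hc (x := eta_p t) (y := xp t) tr tr; rewrite e1 in h1.
  by apply: le_trans (ler_wpM2l (ltW kappa_gt0) h1) _; rewrite mulrDr !(mulrCA kappa).
Qed.
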